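(* Let $d\ge2$ and let $f(x)=e^{-m|x|}g(|x|)$ be a density on $\mathbb{R}^d$ satisfying assumption (B). Then $$h_n(x)\le M_3^{\,n-1}H_n(|x|),\qquad x\in\mathbb{R}^d,\ n\ge1,$$ where $$M_3:=1\vee\left(\frac{2\pi^{\frac{d-1}{2}}}{\Gamma\left(\frac{d-1}{2}\right)}\int_0^\infty\exp\left(-\frac{m}{\pi^2}\frac{s^2}{\sqrt{1+s^2}}\right)s^{d-2}\,ds\right).$$
   Context: $\mathbb{N}=\{1,2,\dots\}$, $a\vee b=\max(a,b)$; $|x|$ is the Euclidean norm. A density is a nonnegative nonzero function in $L^1(\mathbb{R}^d)$ (Lebesgue measure). ''Decreasing'' is meant in the non-strict sense. Assumption (B): $f$ is a density of the form $f(x)=e^{-m|x|}g(|x|)$, where $m>0$ and $g:[0,\infty)\to(0,\infty]$ is such that (a) $g$ is a decreasing function; (b) there is a constant $C_3\ge1$ such that $g(r)\le C_3g(2r)$ for $r>0$. Functions $h_n$: $h_1\equiv1$ on $\mathbb{R}^d$ and, for $n\in\mathbb{N}$, $$h_{n+1}(x):=\frac{\int_{D(x)}f(x-y)f(y)h_n(y)\,dy}{f(x)},\qquad D(x)=\{z\in\mathbb{R}^d:|z|<|x|-1,\ |x-z|<|x|-1\}.$$ An integral over the empty set equals $0$ and $a/(+\infty)=0$ for $a\ge0$. Functions $H_n$: $H_1\equiv1$ on $[0,\infty)$ and, for $n\in\mathbb{N}$, $H_{n+1}\equiv0$ on $[0,2]$ and $$H_{n+1}(r):=\frac{1}{g(r)\,r^{\frac{d-1}{2}}}\int_1^{r-1}g(r-\rho)(r-\rho)^{\frac{d-1}{2}}g(\rho)\rho^{\frac{d-1}{2}}H_n(\rho)\,d\rho,\qquad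 r>2.$$ *)

(* Defs.v *)
From HB Require Import structures.
From mathcomp Require Import all_boot all_order all_algebra.
From mathcomp Require Import all_classical all_reals all_analysis.

Set Implicit Arguments.
Unset Strict Implicit.
Unset Printing Implicit Defensive.
Import Order.TTheory GRing.Theory Num.Theory.
Import numFieldNormedType.Exports.

Local Open Scope classical_set_scope.
Local Open Scope ring_scope.

(* R^n is represented by the measurable type of n-tuples, which carries the
   product (Borel) sigma-algebra. *)
Notation "''RR[' R ]_ n" := (n.-tuple (measurableTypeR R))
  (at level 8, n at level 2, format "''RR[' R ]_ n") : type_scope.

Section lebesgue_measure_tuple.
Context {R : realType}.

Definition cons_tuple {n} (p : measurableTypeR R * 'RR[R]_n) : 'RR[R]_n.+1 :=
  [tuple of p.1 :: p.2].

Lemma measurable_cons_tuple n :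
  measurable_fun [set: measurableTypeR R * 'RR[R]_n] (@cons_tuple n).
Proof. exact: measurable_cons. Qed.

Definition lebesgue_cons {n} (mu : {measure set 'RR[R]_n -> \bar R}) :
    set 'RR[R]_n.+1 -> \bar R :=
  pushforward (@lebesgue_measure R \x^ mu)%E cons_tuple.

HB.instance Definition _ n (mu : {measure set 'RR[R]_n -> \bar R}) :=
  Measure.copy (lebesgue_cons mu)
    (measure_function_pushforward__canonical__measure_function_Measure
      (@lebesgue_measure R \x^ mu)%E (@measurable_cons_tuple n)).

Fixpoint lebesgue_tuple n : {measure set 'RR[R]_n -> \bar R} :=
  if n is n'.+1 then lebesgue_cons (lebesgue_tuple n') else \d_[tuple].

End lebesgue_measure_tuple.

(* The defining property of Lebesgue measure: measurable boxes. *)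
Lemma lebesgue_tuple_box (R : realType) n (A : 'I_n -> set (measurableTypeR R)) :
    (forall i, measurable (A i)) ->
  lebesgue_tuple n [set x : 'RR[R]_n | forall i, A i (tnth x i)] =
    (\prod_(i < n) @lebesgue_measure R (A i))%E.
Proof.
elim: n A => [|n IHn] A mA.
  rewrite big_ord0 /= diracE mem_set//; by case.
rewrite big_ord_recl /=.
set X := [set x | _]; set B := [set x : 'RR[R]_n |
  forall i, A (lift ord0 i) (tnth x i)].
have mB : measurable B.
  rewrite (_ : B = \bigcap_(i in [set: 'I_n]) ((@tnth n _)^~ i @^-1` A (lift ord0 i))).
    apply: fin_bigcap_measurable => // i _.
    by rewrite -[X in measurable X]setTI; exact: measurable_tnth.
  by apply/seteqP; split=> [x xB i _|x xB i]; exact: xB.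
have XE : cons_tuple @^-1` X = A ord0 `*` B.
  apply/seteqP; split=> [[a x] /= xX|[a x] [/= aA xB]].
    split; first by have := xX ord0; rewrite tnth0.
    by move=> i; have := xX (lift ord0 i); rewrite tnthS.
  move=> i; case: (unliftP ord0 i) => [j ->|->]; first by rewrite tnthS; exact: xB.
  by rewrite tnth0.
rewrite /lebesgue_cons /pushforward XE product_measure2E//.
by rewrite (IHn (A \o lift ord0))// => i; exact: mA.
Qed.

Section theorem_objects.
Context {R : realType}.

Definition enorm {d} (x : 'RR[R]_d) : R :=
  Num.sqrt (\sum_(i < d) (tnth x i : R) ^+ 2).

Definition subt {d} (x y : 'RR[R]_d) : 'RR[R]_d :=
  [tuple (tnth x i : R) - tnth y i | i < d].

Definition density {d} (f : 'RR[R]_d -> \bar R) : Prop :=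
  [/\ (forall x, 0 <= f x)%E,
      (lebesgue_tuple d).-integrable setT f &
      ~ {ae lebesgue_tuple d, forall x, f x = 0%E}].

(* g is only constrained on [0, +oo[; its values on negative reals are
   irrelevant and never used. *)
Definition assumption_B {d} (m : R) (g : R -> \bar R) (f : 'RR[R]_d -> \bar R) :
    Prop :=
  [/\ density f,
      0 < m,
      (forall x, f x = (expR (- m * enorm x))%:E * g (enorm x))%E &
   [/\ (forall r : R, (0 <= r)%R -> 0 < g r)%E,
       (forall r s : R, (0 <= r)%R -> (r <= s)%R -> g s <= g r)%E &
       exists2 C3 : R, 1 <= C3 &
         (forall r : R, (0 < r)%R -> g r <= C3%:E * g (2 * r)%R)%E]].

Definition D_set {d} (x : 'RR[R]_d) : set 'RR[R]_d :=
  [set z | enorm z < enorm x - 1 /\ enorm (subt x z) < enorm x - 1].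

(* Sequences indexed by n >= 1; the value at n = 0 is a dummy. Extended-real
   division satisfies a / +oo = 0. *)
Fixpoint hfun {d} (f : 'RR[R]_d -> \bar R) (n : nat) : 'RR[R]_d -> \bar R :=
  match n with
  | 0%N | 1%N => cst 1%E
  | n'.+1 => fun x =>
      ((\int[lebesgue_tuple d]_(y in D_set x) (f (subt x y) * f y * hfun f n' y))
       / f x)%E
  end.

Fixpoint Hfun (d : nat) (g : R -> \bar R) (n : nat) : R -> \bar R :=
  match n with
  | 0%N | 1%N => cst 1%E
  | n'.+1 => fun r =>
      let a : R := (d%:R - 1) / 2 in
      if r <= 2 then 0%E else
      ((g r * (r `^ a)%:E)^-1 *
       \int[@lebesgue_measure R]_(rho in `[1%R, (r - 1)%R])
         (g (r - rho)%R * ((r - rho) `^ a)%:E * g rho * (rho `^ a)%:E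
          * Hfun d g n' rho))%E
  end.

Definition Gamma (s : R) : R :=
  (\int[@lebesgue_measure R]_(t in `]0%R, +oo[) (t `^ (s - 1) * expR (- t)))%R.

(* The exponent d - 2 is a truncated subtraction, exact for d >= 2. *)
Definition M3 (d : nat) (m : R) : R :=
  Num.max 1
    (2 * pi `^ ((d%:R - 1) / 2) / Gamma ((d%:R - 1) / 2) *
     (\int[@lebesgue_measure R]_(s in `[0%R, +oo[)
        (expR (- (m / pi ^+ 2) * (s ^+ 2 / Num.sqrt (1 + s ^+ 2)))
         * s ^+ (d - 2)))).

End theorem_objects.

(* Main.v *)
Require Import Defs.
From HB Require Import structures.
From mathcomp Require Import all_boot all_order all_algebra.
From mathcomp Require Import all_classical all_reals all_analysis.
From mathcomp Require Import measurable_realfun ring lra.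
Import Order.TTheory GRing.Theory Num.Theory.
Import numFieldNormedType.Exports.

(** Write [r] for the length of [x] and [rho] for that of [y]. On the domain of
    integration [1 < rho < r - 1], and the triangle inequality gives
    [g (enorm (x - y)) <= g (r - rho)] because [g] decreases. By induction on the
    index, everything except the exponential factor then depends on [rho] alone:
    what is left to estimate is the integral over the sphere of radius [rho] of
    [exp (- m * (enorm (x - y) + rho - r))]. If [theta] is the angle between [x]
    and [y], and [a = r - rho], then
    [enorm (x - y) = sqrt (a ^ 2 + 2 * r * rho * (1 - cos theta))], and
    [1 - cos theta >= theta ^ 2 / pi ^ 2], so that the exponent is at most
    [- (m / pi ^ 2) * s ^ 2 / sqrt (1 + s ^ 2)] for
    [s = theta * sqrt (r * rho / a)] ([distance_excess]; this uses [a >= 1]).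
    The sphere of radius [rho] has the area element
    [rho ^ (d - 1) * sin theta ^ (d - 2)] in [theta], times the area of the unit
    sphere of dimension [d - 2]; with [sin theta <= theta], passing from [theta]
    to [s] yields the constant [M3] and the factor
    [(rho * (r - rho) / r) ^ ((d - 1) / 2)] ([angular_integral_le_M3]), which are
    those of the recursion for [Hfun].

    Spherical coordinates around [x] are derived from Tonelli's theorem by
    changes of a single variable. Integrals of functions of the scalar product
    with [x] and of the norm do not depend on the direction of [x]
    ([ge0_integral_dotp_sqn]): induction on the dimension reduces this to plane
    rotations, and these factor into affine changes of one variable. The
    cotangent [u] of [theta] serves as angular variable: in the half-plane with
    coordinates [t] (along [x]) and [s] (distance to the axis), [t = s * u]
    followed by [s = rho / sqrt (1 + u ^ 2)] are again dilations
    ([polar_plane]). The same computation proves by induction that integrals of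
    radial functions are one-dimensional up to a constant ([radial_exists]), and
    the Gaussian function identifies the constant as a quotient of a power of
    [pi] by a value of Gamma ([ge0_integral_radial]). Both facts together are
    [ge0_integral_axial]. *)

Set Implicit Arguments.
Unset Strict Implicit.
Unset Printing Implicit Defensive.

Local Open Scope classical_set_scope.
Local Open Scope ring_scope.

(** * Affine changes of variable on the line *)

Section affine.
Context {R : realType}.
Local Notation mu := (@lebesgue_measure R).

Lemma measurable_affine (a b : R) :
  measurable_fun [set: measurableTypeR R]
    (fun t : measurableTypeR R => a * t + b : measurableTypeR R).
Proof. by apply: measurable_funD => //; exact: measurable_funM. Qed.

(** Both sides are measures, and they agree on half-open intervals. *)
Lemma lebesgue_measure_affine (a b : R) (A : set (measurableTypeR R)) :
  0 < a -> measurable A ->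
  (a%:E * mu ((fun t => (a * t + b)%R) @^-1` A))%E = mu A.
Proof.
move=> a0 mA; apply/esym.
pose nu : {measure set (measurableTypeR R) -> \bar R} :=
  mscale (NngNum (ltW a0))
    (measure_function_pushforward__canonical__measure_function_Measure
      mu (measurable_affine a b)).
apply: (@lebesgue_measure_unique R nu) => // _ [[x y] _ <-] /=.
rewrite /nu/= /mscale/= /pushforward.
rewrite (_ : _ @^-1` _ = `](x - b) / a, (y - b) / a]%classic); last first.
  apply/seteqP; split=> t /=; rewrite !in_itv/=.
    by rewrite ltr_pdivrMr// ler_pdivlMr// ltrBlDr lerBrDr mulrC.
  by rewrite ltr_pdivrMr// ler_pdivlMr// ltrBlDr lerBrDr mulrC.
rewrite !lebesgue_measure_itv/= !lte_fin ltr_pM2r ?invr_gt0// ltrD2r.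
case: ifPn => _; last by rewrite mule0.
by rewrite -!EFinD -EFinM; congr EFin; field; rewrite gt_eqF.
Qed.

Lemma ge0_integral_affine_pos (a b : R) (phi : measurableTypeR R -> \bar R) :
  0 < a -> measurable_fun setT phi -> (forall t, 0 <= phi t)%E ->
  (\int[mu]_t phi t = a%:E * \int[mu]_t phi (a * t + b)%R)%E.
Proof.
move=> a0 mphi phi0.
have := @ge0_integral_pushforward _ _ _ _ R _ (measurable_affine a b) mu
  setT phi measurableT mphi (fun x _ => phi0 x).
rewrite preimage_setT => /= <-.
rewrite -(@ge0_integral_mscale _ _ _
    (measure_function_pushforward__canonical__measure_function_Measure
      mu (measurable_affine a b)) _ measurableT (NngNum (ltW a0)))//.
apply: eq_measure_integral => A mA _ /=.
by rewrite /mscale /pushforward /= lebesgue_measure_affine.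
Qed.

(** Reflection reduces a negative dilation factor to a positive one. *)
Lemma ge0_integral_affine (a b : R) (phi : measurableTypeR R -> \bar R) :
  a != 0 -> measurable_fun setT phi -> (forall t, 0 <= phi t)%E ->
  (\int[mu]_t phi t = `|a|%:E * \int[mu]_t phi (a * t + b)%R)%E.
Proof.
move=> a0 mphi phi0; have [a_lt0|a_gt0|a_eq0] := ltgtP a 0; last 1 first.
- by rewrite a_eq0 eqxx in a0.
- rewrite (_ : (\int[mu]_t phi t = \int[mu]_t phi (- t)%R)%E); last first.
    have mN : measurable_fun [set: measurableTypeR R]
        (-%R : measurableTypeR R -> measurableTypeR R) by [].
    have := @ge0_integral_pushforward _ _ _ _ R _ mN mu setT phi measurableT
      mphi (fun x _ => phi0 x).
    rewrite preimage_setT => /= <-; apply: eq_measure_integral => A mA _ /=.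
    exact/esym/lebesgue_measureN.
  rewrite (@ge0_integral_affine_pos (- a) (- b)) ?oppr_gt0//; last first.
    exact: measurableT_comp.
  rewrite ltr0_norm//; congr (_ * _)%E; apply: eq_integral => t _.
  by congr phi; rewrite mulNr opprD !opprK.
- by rewrite gtr0_norm//; exact: ge0_integral_affine_pos.
Qed.

End affine.

(** * Tonelli's theorem for Lebesgue measure on tuples *)

Section tonelli.
Context {R : realType}.
Local Notation mu := (@lebesgue_measure R).

Lemma measurable_box n (A : 'I_n -> set (measurableTypeR R)) :
  (forall i, measurable (A i)) ->
  measurable [set x : 'RR[R]_n | forall i, A i (tnth x i)].
Proof.
move=> mA.
rewrite (_ : [set _ | _] = \bigcap_(i in [set: 'I_n])
    ((@tnth n _)^~ i @^-1` A i)).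
  apply: fin_bigcap_measurable => // i _.
  by rewrite -[X in measurable X]setTI; exact: measurable_tnth.
by apply/seteqP; split=> [x xB i _|x xB i]; exact: xB.
Qed.

Lemma sigma_finite_lebesgue_tuple n :
  sigma_finite [set: 'RR[R]_n] (lebesgue_tuple n).
Proof.
exists (fun k : nat => [set x : 'RR[R]_n | forall i,
  `[- k%:R, k%:R]%classic (tnth x i)]).
  apply/esym; rewrite -subTset => x _.
  pose M : R := \sum_(i < n) `|tnth x i : R|.
  exists (Num.truncn M).+1 => //= i; rewrite in_itv/= -ler_norml.
  apply: (@le_trans _ _ M); last by rewrite ltW// Num.Theory.truncnS_gt.
  by rewrite /M (bigD1 i)//= lerDl; apply: sumr_ge0.
move=> k; split.
  exact: (@measurable_box _ (fun=> `[- k%:R, k%:R]%classic)).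
rewrite (@lebesgue_tuple_box R n (fun=> `[- k%:R, k%:R]%classic))//.
rewrite -ge0_fin_numE; last exact: prode_ge0.
apply: (big_ind (fun y => y \is a fin_num)) => // [x y|i _].
  exact: fin_numM.
by rewrite lebesgue_measure_itv; case: ifP.
Qed.

(** Lebesgue measure under a separate name, to which the sigma-finiteness asked
    for by Tonelli's theorem can be attached. *)
Definition lebesgue_vec n : set 'RR[R]_n -> \bar R := lebesgue_tuple n.
HB.instance Definition _ n := Measure.copy (@lebesgue_vec n) (lebesgue_tuple n).
HB.instance Definition _ n := Measure_isSigmaFinite.Build _ _ _ (@lebesgue_vec n)
  (sigma_finite_lebesgue_tuple n).

(** Lebesgue measure on (n+1)-tuples is the image of a product measure, so that
    integrals split off the first coordinate. *)
Lemma integral_lebesgue_cons n (F : 'RR[R]_n.+1 -> \bar R) :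
  measurable_fun setT F -> (forall y, 0 <= F y)%E ->
  (\int[lebesgue_tuple n.+1]_y F y =
   \int[@lebesgue_vec n]_z \int[mu]_t F (Defs.cons_tuple (t, z)))%E.
Proof.
move=> mF F0.
have mG : measurable_fun setT (F \o @Defs.cons_tuple R n).
  exact: measurableT_comp (@Defs.measurable_cons_tuple R n).
rewrite /= /lebesgue_cons.
have := @ge0_integral_pushforward _ _ _ _ R _ (@Defs.measurable_cons_tuple R n)
  (mu \x^ @lebesgue_vec n)%E setT F measurableT mF (fun x _ => F0 x).
rewrite preimage_setT => /= ->.
have mu12 (A : set (measurableTypeR R * 'RR[R]_n)) : measurable A ->
    ((mu \x @lebesgue_vec n) A = (mu \x^ @lebesgue_vec n) A)%E.
  apply: (@product_measure_unique _ _ _ _ R mu (@lebesgue_vec n)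
    (mu \x^ @lebesgue_vec n)%E) => A1 A2 mA1 mA2.
  exact: product_measure2E.
have := @eq_measure_integral _ _ R setT (mu \x @lebesgue_vec n)%E
  (mu \x^ @lebesgue_vec n)%E (F \o @Defs.cons_tuple R n).
move=> -> //.
  by rewrite fubini_tonelli2// => x; exact: F0.
by move=> A mA _; exact/esym/mu12.
Qed.

End tonelli.

(** * Rotation invariance *)

Section rotation.
Context {R : realType}.
Local Notation mu := (@lebesgue_measure R).
Local Notation RR := (measurableTypeR R).

Definition dotp {n} (x y : 'RR[R]_n) : R :=
  \sum_(i < n) (tnth x i : R) * (tnth y i : R).

Definition sqn {n} (y : 'RR[R]_n) : R := \sum_(i < n) (tnth y i : R) ^+ 2.

Lemma sqn_ge0 n (y : 'RR[R]_n) : 0 <= sqn y.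
Proof. by apply: sumr_ge0 => i _; exact: sqr_ge0. Qed.

Lemma dotp_cons n (x : 'RR[R]_n.+1) t (z : 'RR[R]_n) :
  dotp x (Defs.cons_tuple (t, z)) =
  (thead x : R) * t + dotp [tuple of behead x] z.
Proof.
rewrite /dotp big_ord_recl tnth0; congr (_ + _).
by apply: eq_bigr => i _; rewrite tnthS tnth_behead; congr (tnth x _ * _);
   apply/val_inj; rewrite /= inordK// ltnS.
Qed.

Lemma sqn_cons n t (z : 'RR[R]_n) :
  sqn (Defs.cons_tuple (t, z)) = (t : R) ^+ 2 + sqn z.
Proof.
rewrite /sqn big_ord_recl tnth0; congr (_ + _).
by apply: eq_bigr => i _; rewrite tnthS.
Qed.

Lemma sqn_behead n (x : 'RR[R]_n.+1) :
  sqn x = (thead x : R) ^+ 2 + sqn [tuple of behead x].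
Proof. by rewrite [in LHS](tuple_eta x) -sqn_cons. Qed.

Lemma sqn0 (z : 'RR[R]_0) : sqn z = 0.
Proof. by rewrite /sqn big_ord0. Qed.

Lemma measurable_dotp n (x : 'RR[R]_n) :
  measurable_fun setT (dotp x : _ -> RR).
Proof.
apply: measurable_sum => i; apply: measurable_funM => //.
exact: measurable_tnth.
Qed.

Lemma measurable_sqn n : measurable_fun setT (@sqn n : _ -> RR).
Proof.
by apply: measurable_sum => i; apply: measurable_funX; exact: measurable_tnth.
Qed.

Lemma measurable_comp_pair d (T : measurableType d) (K : RR * RR -> \bar R)
    (u v : T -> RR) :
  measurable_fun setT K -> measurable_fun setT u -> measurable_fun setT v ->
  measurable_fun setT (fun x => K (u x, v x)).
Proof.
move=> mK mu' mv; apply: (measurableT_comp mK).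
exact: measurable_fun_pair.
Qed.

Lemma measurable_integral2 d1 d2 (T1 : measurableType d1)
    (T2 : measurableType d2) (nu : {sigma_finite_measure set T2 -> \bar R})
    (F : T1 * T2 -> \bar R) :
  measurable_fun setT F -> (forall p, 0 <= F p)%E ->
  measurable_fun setT (fun s => \int[nu]_t F (s, t))%E.
Proof. exact: measurable_fun_fubini_tonelli_F. Qed.

Lemma integral_swap (F : RR * RR -> \bar R) :
  measurable_fun setT F -> (forall p, 0 <= F p)%E ->
  (\int[mu]_s \int[mu]_t F (s, t) = \int[mu]_t \int[mu]_s F (s, t))%E.
Proof. exact: fubini_tonelli. Qed.

End rotation.

(** Structural measurability. Powers come before products, since a power
    also unfolds to a product. *)
Ltac meas := repeat first
  [ exact: measurable_cst | exact: measurable_fst | exact: measurable_snd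
  | exact: measurable_id
  | exact: measurable_sqn | exact: measurable_dotp
  | assumption
  | apply: measurable_comp_pair
  | apply: measurable_funX | apply: measurable_funD | apply: measurable_funB
  | apply: measurable_funM | apply: measurable_funN
  | apply: (measurableT_comp (measurable_sqn _)) ].

Section rotation_invariance.
Context {R : realType}.
Local Notation mu := (@lebesgue_measure R).
Local Notation RR := (measurableTypeR R).

(** With [n] the length of (a, b), the rotation that sends (a, b) to the first
    axis factors, when [a != 0], into two affine changes of a single variable,
    whose Jacobians [n / a] and [a / n] cancel. *)
Lemma plane_rotation_neq0 (K : RR * RR -> \bar R) (a b : R) : a != 0 ->
  measurable_fun setT K -> (forall p, 0 <= K p)%E ->
  (\int[mu]_t \int[mu]_s K (a * s + b * t, s ^+ 2 + t ^+ 2)%R =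
   \int[mu]_s \int[mu]_t K (Num.sqrt (a ^+ 2 + b ^+ 2) * s, s ^+ 2 + t ^+ 2)%R)%E.
Proof.
move=> a0 mK K0; set n := Num.sqrt _.
have n2 : n ^+ 2 = a ^+ 2 + b ^+ 2 by rewrite sqr_sqrtr// addr_ge0 ?sqr_ge0.
have n0 : 0 < n by rewrite sqrtr_gt0 ltr_pwDl ?sqr_ge0// exprn_even_gt0.
have n_neq0 : n != 0 by rewrite gt_eqF.
pose F (p : RR * RR) : \bar R :=
  K (n * p.2, (n / a * p.2 - b * p.1 / a) ^+ 2 + p.1 ^+ 2).
have mF : measurable_fun setT F by rewrite /F; meas.
transitivity (\int[mu]_t (`|n / a|%:E * \int[mu]_w F (t, w)))%E.
  apply: eq_integral => t _.
  rewrite (@ge0_integral_affine _ (n / a) (- (b * t / a)))//; last 2 first.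
  - by rewrite mulf_neq0// invr_eq0.
  - by meas.
  congr (_ * _)%E; apply: eq_integral => w _; rewrite /F/=; congr K.
  by congr pair; field.
rewrite ge0_integralZl//; last 2 first.
- by apply: measurable_integral2 mF _ => p; exact: K0.
- by move=> t _; apply: integral_ge0 => w _; exact: K0.
rewrite (integral_swap mF) => [|p]; last exact: K0.
pose G (p : RR * RR) : \bar R := K (n * p.1, p.1 ^+ 2 + p.2 ^+ 2).
have mG : measurable_fun setT G by rewrite /G; meas.
transitivity (`|n / a|%:E * \int[mu]_w (`|a / n|%:E * \int[mu]_v G (w, v)))%E.
  congr (_ * _)%E; apply: eq_integral => w _.
  have mFw : measurable_fun setT (fun t : RR => F (t, w)).
    by rewrite /F/=; meas.
  have an0 : a / n != 0 by rewrite mulf_neq0// invr_eq0.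
  rewrite (ge0_integral_affine (b * w / n) an0 mFw); last first.
    by move=> t; exact: K0.
  congr (_ * _)%E; apply: eq_integral => v _; rewrite /F/G/=; congr K.
  congr pair.
  have -> : (n / a * w - b * (a / n * v + b * w / n) / a) =
            (a * w - b * v) / n + (n ^+ 2 - (a ^+ 2 + b ^+ 2)) * w / (a * n).
    by field; apply/andP.
  rewrite n2 subrr !mul0r addr0.
  have -> : w ^+ 2 + v ^+ 2 = (a ^+ 2 + b ^+ 2) * (w ^+ 2 + v ^+ 2) / n ^+ 2.
    by rewrite -n2 mulrAC divff ?mul1r// expf_neq0.
  by field.
rewrite ge0_integralZl//; last 2 first.
- by apply: measurable_integral2 mG _ => p; exact: K0.
- by move=> t _; apply: integral_ge0 => w _; exact: K0.
rewrite muleA -EFinM -normrM.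
have -> : n / a * (a / n) = 1 by field; apply/andP.
by rewrite normr1 mul1e.
Qed.

Lemma plane_rotation (K : RR * RR -> \bar R) (a b : R) :
  measurable_fun setT K -> (forall p, 0 <= K p)%E ->
  (\int[mu]_s \int[mu]_t K (a * s + b * t, s ^+ 2 + t ^+ 2)%R =
   \int[mu]_s \int[mu]_t K (Num.sqrt (a ^+ 2 + b ^+ 2) * s, s ^+ 2 + t ^+ 2)%R)%E.
Proof.
move=> mK K0.
(* For [a = 0 <> b], exchanging the two variables leads back to the previous
   lemma; for [a = b = 0] both sides are the same. *)
have [a0|a0] := eqVneq a 0; last first.
  apply: etrans (plane_rotation_neq0 b a0 mK K0).
  pose F (p : RR * RR) : \bar R :=
    K (a * p.1 + b * p.2, p.1 ^+ 2 + p.2 ^+ 2).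
  have mF : measurable_fun setT F by rewrite /F; meas.
  by rewrite (integral_swap mF)// => p; exact: K0.
have [b0|b0] := eqVneq b 0.
  by rewrite a0 b0 expr0n/= addr0 sqrtr0; under eq_integral do
    under eq_integral do rewrite !mul0r addr0; apply: eq_integral => s _;
    apply: eq_integral => t _; rewrite mul0r.
have nC : Num.sqrt (a ^+ 2 + b ^+ 2) = Num.sqrt (b ^+ 2 + 0 ^+ 2).
  by rewrite a0 addrC.
rewrite nC; apply: etrans (plane_rotation_neq0 0 b0 mK K0).
apply: eq_integral => s _; apply: eq_integral => t _.
have -> : a * s + b * t = b * t + 0 * s by rewrite a0 addrC.
by rewrite [s ^+ 2 + _]addrC.
Qed.

(** In integrals of functions of the scalar product and of the length, the
    direction of the fixed vector can be taken to be that of the first axis: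
    the induction hypothesis aligns the last coordinates of [x] with the second
    axis, and a plane rotation does the rest. *)
Lemma ge0_integral_dotp_sqn n (x : 'RR[R]_n.+1) (K : RR * RR -> \bar R) :
  measurable_fun setT K -> (forall p, 0 <= K p)%E ->
  (\int[lebesgue_tuple n.+1]_y K (dotp x y, sqn y) =
   \int[@lebesgue_vec R n]_z \int[mu]_t
      K (Num.sqrt (sqn x) * t, t ^+ 2 + sqn z)%R)%E.
Proof.
elim: n x K => [|n IH] x K mK K0.
  have mKx : measurable_fun setT (fun y : 'RR[R]_1 => K (dotp x y, sqn y)).
    by meas.
  rewrite (integral_lebesgue_cons mKx) => [|y]; last exact: K0.
  apply: eq_integral => z _.
  under eq_integral do rewrite dotp_cons sqn_cons {1}/dotp big_ord0 addr0.
  rewrite (sqn_behead x) (sqn0 [tuple of behead x]) addr0 sqrtr_sqr.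
  have [x0|x0] := leP 0 (thead x : R); first by rewrite ger0_norm.
  rewrite ltr0_norm//.
  have N10 : (-1 : R) != 0 by rewrite oppr_eq0 oner_eq0.
  have mKz : measurable_fun setT
      (fun t : RR => K (- (thead x : R) * t, t ^+ 2 + sqn z)) by meas.
  rewrite (ge0_integral_affine 0 N10 mKz) => [|t]; last exact: K0.
  rewrite normrN normr1 mul1e; apply: eq_integral => t _.
  by rewrite addr0 mulN1r mulrN mulNr opprK sqrrN.
have mKx : measurable_fun setT (fun y : 'RR[R]_n.+2 => K (dotp x y, sqn y)).
  by meas.
rewrite (integral_lebesgue_cons mKx) => [|y]; last exact: K0.
set x1 : R := thead x; set x' := [tuple of behead x].
under eq_integral do under eq_integral do rewrite dotp_cons sqn_cons -/x1 -/x'.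
pose F1 (p : RR * 'RR[R]_n.+1) : \bar R :=
  K (x1 * p.1 + dotp x' p.2, p.1 ^+ 2 + sqn p.2).
have mF1 : measurable_fun setT F1.
  rewrite /F1; meas.
  - by apply: (measurableT_comp (measurable_dotp x')).
  - by apply: (measurableT_comp (@measurable_sqn R n.+1)).
rewrite -(fubini_tonelli F1 mF1) => [|p]; last exact: K0.
pose F2 (p : RR * 'RR[R]_n.+1) : \bar R :=
  K (Num.sqrt (sqn x) * p.1, p.1 ^+ 2 + sqn p.2).
have mF2 : measurable_fun setT F2.
  rewrite /F2; meas.
  by apply: (measurableT_comp (@measurable_sqn R n.+1)).
rewrite -(fubini_tonelli F2 mF2) => [|p]; last exact: K0.
pose G1 (p : (RR * 'RR[R]_n) * RR) : \bar R :=
  K (x1 * p.1.1 + Num.sqrt (sqn x') * p.2, p.1.1 ^+ 2 + (p.2 ^+ 2 + sqn p.1.2)).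
pose G2 (p : (RR * 'RR[R]_n) * RR) : \bar R :=
  K (Num.sqrt (sqn x) * p.1.1, p.1.1 ^+ 2 + (p.2 ^+ 2 + sqn p.1.2)).
have m11 : measurable_fun setT (fun p : (RR * 'RR[R]_n) * RR => p.1.1).
  by apply: measurableT_comp.
have m12 : measurable_fun setT (fun p : (RR * 'RR[R]_n) * RR => sqn p.1.2 : RR).
  by apply: (measurableT_comp (@measurable_sqn R n)); apply: measurableT_comp.
have mG1 : measurable_fun setT G1 by rewrite /G1; meas.
have mG2 : measurable_fun setT G2 by rewrite /G2; meas.
transitivity (\int[mu]_t \int[@lebesgue_vec R n]_z \int[mu]_s G1 ((t, z), s))%E.
  apply: eq_integral => t _.
  have mK' : measurable_fun setT (fun p : RR * RR => K (x1 * t + p.1, t ^+ 2 + p.2)).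
    by meas.
  exact: (IH x' (fun p : RR * RR => K (x1 * t + p.1, t ^+ 2 + p.2)) mK'
    (fun=> K0 _)).
transitivity (\int[mu]_t \int[@lebesgue_vec R n]_z \int[mu]_s G2 ((t, z), s))%E;
    last first.
  apply: eq_integral => t _.
  have mF2t : measurable_fun setT (fun z => F2 (t, z)).
    by rewrite /F2/=; meas; exact: (@measurable_sqn R n.+1).
  rewrite [RHS](integral_lebesgue_cons mF2t) => [|z]; last exact: K0.
  apply: eq_integral => z _; apply: eq_integral => s _.
  by rewrite /G2/F2 /= sqn_cons.
have mI1 := measurable_integral2 mu mG1 (fun=> K0 _).
have mI2 := measurable_integral2 mu mG2 (fun=> K0 _).
rewrite (fubini_tonelli _ mI1) => [|p]; last by apply: integral_ge0 => s _; exact: K0.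
rewrite (fubini_tonelli _ mI2) => [|p]; last by apply: integral_ge0 => s _; exact: K0.
apply: eq_integral => z _.
have mK' : measurable_fun setT (fun p : RR * RR => K (p.1, p.2 + sqn z)).
  by meas.
have nE : x1 ^+ 2 + Num.sqrt (sqn x') ^+ 2 = sqn x.
  by rewrite (sqr_sqrtr (sqn_ge0 x')) (sqn_behead x).
have := plane_rotation x1 (Num.sqrt (sqn x')) mK' (fun=> K0 _).
rewrite nE => rotation.
transitivity (\int[mu]_t \int[mu]_s
    K (x1 * t + Num.sqrt (sqn x') * s, t ^+ 2 + s ^+ 2 + sqn z)%R)%E.
  by apply: eq_integral => t _; apply: eq_integral => s _; rewrite /G1/= addrA.
rewrite [LHS]rotation.
by apply: eq_integral => t _; apply: eq_integral => s _; rewrite /G2/= addrA.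
Qed.

End rotation_invariance.

(** * Polar coordinates in a half-plane *)

Section polar.
Context {R : realType}.
Local Notation mu := (@lebesgue_measure R).
Local Notation RR := (measurableTypeR R).

(** The radial weight, extended by zero so that all one-dimensional integrals
    range over the whole line. *)
Definition ppow n (s : R) : R := if 0 < s then s ^+ n else 0.

(** If [u] is the cotangent of an angle of [0, pi], then [(hyp u)^-1] is its sine
    and [u / hyp u] its cosine. *)
Definition hyp (u : R) : R := Num.sqrt (1 + u ^+ 2).

Lemma ppow_ge0 n s : 0 <= ppow n s.
Proof. by rewrite /ppow; case: ifP => // s0; rewrite exprn_ge0// ltW. Qed.

Lemma ppow_pos n s : 0 < s -> ppow n s = s ^+ n.
Proof. by rewrite /ppow => ->. Qed.

Lemma ppow_npos n s : s <= 0 -> ppow n s = 0.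
Proof. by rewrite /ppow leNgt; case: (0 < s). Qed.

Lemma measurable_ppow n : measurable_fun setT (ppow n : RR -> RR).
Proof.
by apply: measurable_fun_ifT => //; exact: measurable_fun_ltr.
Qed.

Lemma hyp_gt0 u : 0 < hyp u.
Proof. by rewrite sqrtr_gt0 ltr_pwDl// sqr_ge0. Qed.

Lemma hyp_neq0 u : hyp u != 0.
Proof. by rewrite gt_eqF// hyp_gt0. Qed.

Lemma hyp2 u : hyp u ^+ 2 = 1 + u ^+ 2.
Proof. by rewrite sqr_sqrtr// addr_ge0// sqr_ge0. Qed.

Lemma continuous_hypV : continuous (fun u : R => (hyp u)^-1).
Proof.
move=> u; apply: cvgV; first exact: hyp_neq0.
apply: continuous_comp; last exact: sqrt_continuous.
by apply: cvgD; [exact: cvg_cst|exact: exprn_continuous].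
Qed.

Lemma measurable_hypV : measurable_fun setT ((fun u => (hyp u)^-1) : RR -> RR).
Proof. exact: (continuous_measurable_fun continuous_hypV). Qed.

End polar.

Ltac meash := repeat first
  [ progress meas | apply: (measurableT_comp (measurable_ppow _))
  | apply: (measurableT_comp measurable_hypV) ].

Section polar_plane.
Context {R : realType}.
Local Notation mu := (@lebesgue_measure R).
Local Notation RR := (measurableTypeR R).

(** Polar coordinates, with the cotangent [u] as angular variable. With it the
    change of variables only takes dilations of one variable at a time: [t = s u]
    for fixed [s], and then [s = r / hyp u] for fixed [u]. *)
Lemma polar_plane n (K : RR * RR -> \bar R) :
  measurable_fun setT K -> (forall p, 0 <= K p)%E ->
  (\int[mu]_s ((ppow n s)%:E * \int[mu]_t K (t, t ^+ 2 + s ^+ 2)%R) =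
   \int[mu]_r ((ppow n.+1 r)%:E *
     \int[mu]_u (((hyp u)^-1 ^+ n.+2)%:E * K (r * (u / hyp u), r ^+ 2)%R)))%E.
Proof.
move=> mK K0.
pose F (p : RR * RR) : \bar R :=
  ((ppow n.+1 p.1)%:E * K (p.1 * p.2, (p.1 * p.2) ^+ 2 + p.1 ^+ 2)%R)%E.
have mF : measurable_fun setT F.
  rewrite /F; apply: emeasurable_funM; last by meas.
  by apply/measurable_EFinP; meash.
have F0 p : (0 <= F p)%E by rewrite mule_ge0// lee_fin ppow_ge0.
pose G (p : RR * RR) : \bar R := ((ppow n.+1 p.1)%:E *
  (((hyp p.2)^-1 ^+ n.+2)%:E * K (p.1 * (p.2 / hyp p.2), p.1 ^+ 2)%R))%E.
have mG : measurable_fun setT G.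
  rewrite /G; apply: emeasurable_funM.
    by apply/measurable_EFinP; meash.
  apply: emeasurable_funM.
    by apply/measurable_EFinP; meash.
  by meash.
have G0 p : (0 <= G p)%E.
  by rewrite !mule_ge0// lee_fin ?ppow_ge0// exprn_ge0// invr_ge0 ltW// hyp_gt0.
transitivity (\int[mu]_s \int[mu]_u F (s, u))%E.
  apply: eq_integral => s _.
  have [s0|s0] := leP s 0.
    rewrite ppow_npos// mul0e integral0_eq// => u _.
    by rewrite /F ppow_npos//= mul0e.
  have mKs : measurable_fun setT (fun t : RR => K (t, t ^+ 2 + s ^+ 2)).
    by meas.
  rewrite (ge0_integral_affine_pos 0 s0 mKs) => [|t]; last exact: K0.
  rewrite muleA -EFinM -ge0_integralZl//.
  - apply: eq_integral => u _; rewrite /F/= !ppow_pos// (exprSr s n).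
    by rewrite !addr0.
  - by meas.
  - by rewrite lee_fin mulr_ge0 ?ppow_ge0// ltW.
rewrite (integral_swap mF)//.
transitivity (\int[mu]_u \int[mu]_r G (r, u))%E.
  apply: eq_integral => u _.
  have u0 : 0 < (hyp u)^-1 by rewrite invr_gt0 hyp_gt0.
  have mFu : measurable_fun setT (fun s : RR => F (s, u)).
    by apply: (measurableT_comp mF); exact: measurable_fun_pair.
  rewrite (ge0_integral_affine_pos 0 u0 mFu)// -ge0_integralZl//; last 2 first.
  - apply: (measurableT_comp mF); apply: measurable_fun_pair => //.
    by meas.
  - by rewrite lee_fin ltW.
  apply: eq_integral => r _; rewrite /F/G/=.
  have -> : ppow n.+1 ((hyp u)^-1 * r + 0) = (hyp u)^-1 ^+ n.+1 * ppow n.+1 r.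
    rewrite addr0; have [r0|r0] := leP r 0.
      by rewrite !ppow_npos ?mulr0// mulr_ge0_le0// ltW.
    by rewrite !ppow_pos ?mulr_gt0// exprMn.
  rewrite !muleA -!EFinM; congr (_%:E * K (_, _))%E.
  - by rewrite [_ ^+ n.+2]exprS; ring.
  - by rewrite addr0; ring.
  - have := hyp2 u; have := hyp_neq0 u; rewrite addr0.
    set h := hyp u => h0 h2; transitivity (r ^+ 2 * (1 + u ^+ 2) / h ^+ 2).
      by field.
    by rewrite -h2 mulfK// expf_neq0.
rewrite -(integral_swap mG)//; apply: eq_integral => r _.
rewrite -ge0_integralZl//.
- apply: emeasurable_funM.
    by apply/measurable_EFinP; meash.
  by meash.
- move=> u _; apply: mule_ge0 => //.
  by rewrite lee_fin exprn_ge0// invr_ge0 ltW// hyp_gt0.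
- by rewrite lee_fin ppow_ge0.
Qed.

End polar_plane.

(** * Integrals of radial functions *)

Section radial.
Context {R : realType}.
Local Notation mu := (@lebesgue_measure R).
Local Notation RR := (measurableTypeR R).

Lemma ge0_integral_even (phi : RR -> \bar R) :
  measurable_fun setT phi -> (forall t, 0 <= phi t)%E ->
  (\int[mu]_t phi (t ^+ 2)%R =
   2%:E * \int[mu]_s ((ppow 0 s)%:E * phi (s ^+ 2)%R))%E.
Proof.
move=> mphi phi0; pose f (t : RR) : \bar R := phi (t ^+ 2).
have mf : measurable_fun setT f by apply: (measurableT_comp mphi).
have f0 t : (0 <= f t)%E by exact: phi0.
have mfA (A : set RR) : measurable_fun A f by exact: measurable_funTS.
have -> : (\int[mu]_s ((ppow 0 s)%:E * phi (s ^+ 2)%R) =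
           \int[mu]_(s in `]0%R, +oo[) f s)%E.
  rewrite [RHS]integral_mkcond; apply: eq_integral => s _.
  rewrite patchE /ppow; case: ifPn => s0.
    by rewrite mem_set ?mul1e//= in_itv/= s0.
  by rewrite memNset ?mul0e//= in_itv/= andbT; exact/negP.
have posE := @integral_itv_obnd_cbnd R 0 +oo%O f (mfA _).
have negE := @ge0_integration_by_substitution0 R f mf f0.
transitivity (\int[mu]_(s in `]-oo, 0%R] `|` `]0%R, +oo[) f s)%E.
  rewrite (_ : _ `|` _ = setT)//; apply/seteqP; split=> // t _ /=.
  by rewrite !in_itv/= andbT; case: (leP t 0); [left|right].
rewrite ge0_integral_setU//; last first.
  apply/disj_setPS => t [] /=; rewrite !in_itv/= andbT => t0 /(le_lt_trans t0).
  by rewrite ltxx.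
have -> : (\int[mu]_(s in `]-oo, 0%R]) f s = \int[mu]_(s in `]0%R, +oo[) f s)%E.
  rewrite posE negE; apply: eq_integral => t _.
  by rewrite /f sqrrN.
by rewrite mule_natl mule2n.
Qed.

Lemma integral_lebesgue_tuple0 (F : 'RR[R]_0 -> \bar R) :
  (\int[@lebesgue_vec R 0]_z F z = F [tuple])%E.
Proof.
have -> : F = cst (F [tuple]) by apply/funext => z; rewrite (tuple0 z).
by rewrite integral_dirac// diracE mem_set// mul1e.
Qed.

(** Polar coordinates in the half-plane spanned by the first coordinate and by
    the norm of the others give the induction step, and the constant gets
    multiplied by an integral over the angle. Its value comes only later, from
    the Gaussian function. *)
Lemma radial_exists n : exists2 c : \bar R, (0 <= c)%E &
  forall phi : RR -> \bar R,
    measurable_fun setT phi -> (forall t, 0 <= phi t)%E ->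
    (\int[@lebesgue_vec R n.+1]_z phi (sqn z) =
     c * \int[mu]_s ((ppow n s)%:E * phi (s ^+ 2)%R))%E.
Proof.
elim: n => [|n [c c0 IH]].
  exists 2%:E; first by rewrite lee_fin.
  move=> phi mphi phi0.
  have mphi' : measurable_fun setT (fun z : 'RR[R]_1 => phi (sqn z)).
    by apply: (measurableT_comp mphi); exact: measurable_sqn.
  rewrite [LHS](integral_lebesgue_cons mphi') => [|z]; last exact: phi0.
  rewrite integral_lebesgue_tuple0 -ge0_integral_even//.
  by apply: eq_integral => t _; rewrite sqn_cons sqn0 addr0.
pose W := (\int[mu]_u ((hyp u)^-1 ^+ n.+2)%:E)%E.
exists (c * W)%E.
  apply: mule_ge0 => //; apply: integral_ge0 => u _.
  by rewrite lee_fin exprn_ge0// invr_ge0 ltW// hyp_gt0.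
move=> phi mphi phi0.
have mphi' : measurable_fun setT (fun z : 'RR[R]_n.+2 => phi (sqn z)).
  by apply: (measurableT_comp mphi); exact: measurable_sqn.
rewrite [LHS](integral_lebesgue_cons mphi') => [|z]; last exact: phi0.
pose K (p : RR * RR) := phi p.2.
have mK : measurable_fun setT K by exact: (measurableT_comp mphi).
have mphi1 : measurable_fun setT (fun v : RR => \int[mu]_t phi (t ^+ 2 + v)%R)%E.
  have mF : measurable_fun setT (fun p : RR * RR => phi (p.2 ^+ 2 + p.1)%R).
    by apply: (measurableT_comp mphi); meas.
  exact: (measurable_integral2 mu mF (fun=> phi0 _)).
under eq_integral do under eq_integral do rewrite sqn_cons.
rewrite (IH _ mphi1) => [|v]; last by apply: integral_ge0 => t _.
rewrite (polar_plane n mK) => [|p]; last exact: phi0.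
rewrite -muleA; congr (c * _)%E.
have mW : measurable_fun setT (fun u : RR => ((hyp u)^-1 ^+ n.+2)%:E).
  by apply/measurable_EFinP; meash.
rewrite /K /=.
transitivity (\int[mu]_r (W * ((ppow n.+1 r)%:E * phi (r ^+ 2)%R)))%E.
  apply: eq_integral => r _; rewrite ge0_integralZr//.
    by rewrite muleCA.
  by move=> u _; rewrite lee_fin exprn_ge0// invr_ge0 ltW// hyp_gt0.
rewrite ge0_integralZl//.
- apply: emeasurable_funM; last by apply: (measurableT_comp mphi).
  by apply/measurable_EFinP; exact: measurable_ppow.
- by move=> r _; rewrite mule_ge0// lee_fin ppow_ge0.
- apply: integral_ge0 => u _.
  by rewrite lee_fin exprn_ge0// invr_ge0 ltW// hyp_gt0.
Qed.

Lemma gauss_lebesgue_vec n :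
  (\int[@lebesgue_vec R n]_z (expR (- sqn z))%:E = (Num.sqrt pi ^+ n)%:E)%E.
Proof.
elim: n => [|n IH].
  by rewrite integral_lebesgue_tuple0 sqn0 oppr0 expR0.
have mE k : measurable_fun setT (fun z : 'RR[R]_k => (expR (- sqn z))%:E).
  apply/measurable_EFinP; apply: measurableT_comp => //.
  by apply: measurableT_comp => //; exact: measurable_sqn.
rewrite [LHS](integral_lebesgue_cons (mE _)) => [|z]; last first.
  by rewrite lee_fin expR_ge0.
transitivity (\int[@lebesgue_vec R n]_z
    ((expR (- sqn z))%:E * (Num.sqrt pi)%:E))%E.
  apply: eq_integral => z _; rewrite -integralT_gauss -ge0_integralZl//.
  - apply: eq_integral => t _.
    by rewrite sqn_cons opprD expRD mulrC EFinM.
  - by apply/measurable_EFinP; exact: measurable_gauss_fun.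
  - by move=> t _; rewrite lee_fin expR_ge0.
rewrite ge0_integralZr//; last exact: mE.
rewrite exprSr EFinM; congr (_ * _)%E; exact: IH.
Qed.

End radial.

(** * The Gamma function as a moment of the Gaussian *)

Section gamma.
Context {R : realType}.
Local Notation mu := (@lebesgue_measure R).
Local Notation RR := (measurableTypeR R).

Lemma powR_half (x : R) n : 0 <= x -> x `^ (n%:R / 2) = Num.sqrt x ^+ n.
Proof.
move=> x0; rewrite -powR12_sqrt// mulrC powRrM powR_mulrn//.
exact: powR_ge0.
Qed.

Lemma integral_square_subst (a b : R) (G : R -> R) : 0 < a -> a <= b ->
  {within `[a ^+ 2, b ^+ 2], continuous G} ->
  (\int[mu]_(t in `[(a ^+ 2)%R, (b ^+ 2)%R]) (G t)%:E =
   \int[mu]_(s in `[a, b]) (G (s ^+ 2) * (2 * s))%R%:E)%E.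
Proof.
move=> a0 ab cG.
have dF : derive1 (fun s : R => s ^+ 2) = (fun s => 2 * s).
  by apply/funext => s; rewrite exp_derive1 expr1.
have cF : continuous (fun s : R => 2 * s) by exact: mulrl_continuous.
have c2 : continuous (fun s : R => s ^+ 2) by exact: exprn_continuous.
rewrite (@integration_by_substitution_increasing _ (fun s => s ^+ 2))//.
- by apply: eq_integral => s _ /=; rewrite dF.
- move=> s t; rewrite !in_itv/= => /andP[sa _] /andP[ta _] st.
  by rewrite ltr_pXn2r// nnegrE; apply/ltW; rewrite (lt_le_trans a0).
- by move=> s _; rewrite dF; exact: cF.
- by rewrite dF; apply/cvg_ex; exists (2 * a); apply: cvg_at_right_filter; exact: cF.
- by rewrite dF; apply/cvg_ex; exists (2 * b); apply: cvg_at_left_filter; exact: cF.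
- split; first by move=> s _; exact: exprn_derivable.
    by apply: cvg_at_right_filter; exact: c2.
  by apply: cvg_at_left_filter; exact: c2.
Qed.

Lemma itv0y_bigcup (p : nat) : (0 < p)%N ->
  \bigcup_k `[(k.+1%:R^-1 : R) ^+ p, k.+1%:R ^+ p]%classic = `]0, +oo[%classic.
Proof.
move=> p0; apply/seteqP; split=> t /=.
  move=> [k _] /=; rewrite !in_itv/= andbT => /andP[kt _].
  by apply: lt_le_trans kt; rewrite exprn_gt0// invr_gt0.
rewrite in_itv/= andbT => t0.
pose k := Num.truncn (t + t^-1).
have tk : t + t^-1 <= k.+1%:R by rewrite ltW// truncnS_gt.
have tV : 0 < t^-1 by rewrite invr_gt0.
exists k => //=; rewrite in_itv/=; apply/andP; split.
  apply: (@le_trans _ _ (k.+1%:R^-1)).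
    by rewrite ler_iXnr// ?invr_ge0// invf_le1// ler1n.
  rewrite -[leRHS]invrK lef_pV2 ?posrE//.
  by apply: le_trans tk; rewrite lerDr ltW.
apply: (@le_trans _ _ k.+1%:R); first by apply: le_trans tk; rewrite lerDl ltW.
by rewrite ler_eXnr// ler1n.
Qed.

Lemma itv0y_nondecreasing (p : nat) :
  nondecreasing_seq (fun k => `[(k.+1%:R^-1 : R) ^+ p, k.+1%:R ^+ p]%classic).
Proof.
apply/nondecreasing_seqP => k; rewrite subsetEset => t /=.
rewrite !in_itv/= => /andP[kt tk]; apply/andP; split.
  apply: le_trans kt; rewrite lerXn2r ?nnegrE ?invr_ge0//.
  by rewrite lef_pV2 ?posrE// ler_nat.
by apply: (le_trans tk); rewrite lerXn2r ?nnegrE// ler_nat.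
Qed.

(** Exhausting the half-line by compact intervals leaves no condition on [G] at
    the end points, where the integrand of Gamma can be singular. *)
Lemma integral_square_substy (G : R -> R) : (forall t, 0 < t -> 0 <= G t) ->
  (forall t, 0 < t -> {for t, continuous G}) ->
  (\int[mu]_(t in `]0%R, +oo[) (G t)%:E =
   \int[mu]_(s in `]0%R, +oo[) (G (s ^+ 2) * (2 * s))%R%:E)%E.
Proof.
move=> G0 cG.
pose g (s : R) := G (s ^+ 2) * (2 * s).
have cg s : 0 < s -> {for s, continuous g}.
  move=> s0; apply: cvgM; last exact: mulrl_continuous.
  apply: (@continuous_comp _ _ _ (fun s : R => s ^+ 2) G).
    exact: exprn_continuous.
  by apply: cG; rewrite exprn_gt0.
have pos (p k : nat) (t : R) :
    `[(k.+1%:R^-1 : R) ^+ p, k.+1%:R ^+ p]%classic t -> 0 < t.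
  rewrite /= in_itv/= => /andP[kt _].
  by apply: lt_le_trans kt; rewrite exprn_gt0// invr_gt0.
have within (p k : nat) (h : R -> R) : (forall t, 0 < t -> {for t, continuous h}) ->
    {within `[(k.+1%:R^-1 : R) ^+ p, k.+1%:R ^+ p], continuous h}.
  move=> ch; apply: continuous_in_subspaceT => t /[!inE] /pos; exact: ch.
have lim (p : nat) (h : R -> R) : (0 < p)%N -> (forall t, 0 < t -> 0 <= h t) ->
    (forall t, 0 < t -> {for t, continuous h}) ->
    (\int[mu]_(t in `[((k.+1%:R^-1 : R) ^+ p)%R, (k.+1%:R ^+ p)%R]) (h t)%:E
       @[k --> \oo] --> \int[mu]_(t in `]0%R, +oo[) (h t)%:E)%E.
  move=> p0 h0 ch; rewrite -(itv0y_bigcup p0).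
  apply: ge0_nondecreasing_set_cvg_integral => //.
  - exact: itv0y_nondecreasing.
  - move=> k; apply/measurable_EFinP.
    by apply: subspace_continuous_measurable_fun => //; exact: within.
  - by move=> k t /pos t0; rewrite lee_fin h0.
have := lim 1%N g isT _ cg; have := lim 2%N G isT G0 cG.
move=> limG limg.
have {}limg := limg (fun s s0 => mulr_ge0 (G0 _ (exprn_gt0 2 s0))
  (mulr_ge0 (ler0n _ 2) (ltW s0))).
apply: (cvg_unique _ limG) => //.
apply: cvg_trans limg; apply: near_eq_cvg; near=> k.
rewrite -integral_square_subst//.
- by rewrite !expr1 (@le_trans _ _ 1)// ?invf_le1// ler1n.
- by rewrite !expr1; exact: within.
Unshelve. all: by end_near. Qed.

(** The substitution [t = s ^ 2]. *)
Lemma integral_gamma n :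
  (\int[mu]_(t in `]0%R, +oo[) (t `^ (n.+1%:R / 2 - 1) * expR (- t))%R%:E =
   2%:E * \int[mu]_s ((ppow n s)%:E * (expR (- s ^+ 2))%:E))%E.
Proof.
pose G (t : R) := Num.sqrt t ^+ n / Num.sqrt t * expR (- t).
transitivity (\int[mu]_(t in `]0%R, +oo[) (G t)%:E)%E.
  apply: eq_integral => t; rewrite inE/= in_itv/= andbT => t0.
  have st0 : Num.sqrt t != 0 by rewrite gt_eqF// sqrtr_gt0.
  rewrite /G; congr (_ * _)%:E.
  apply: (@mulIf _ t); first by rewrite gt_eqF.
  rewrite -[X in _ * X]powRr1; last exact: ltW.
  rewrite -powRD; last by rewrite (gt_eqF t0) implybT.
  rewrite subrK powR_half; last exact: ltW.
  by rewrite exprSr -[X in _ = _ * X](sqr_sqrtr (ltW t0)); field.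
rewrite integral_square_substy; last 2 first.
- move=> t t0; rewrite /G.
  by rewrite !mulr_ge0 ?exprn_ge0 ?invr_ge0 ?sqrtr_ge0 ?expR_ge0.
- move=> t t0; have ct : Num.sqrt x @[x --> t] --> Num.sqrt t.
    exact: sqrt_continuous.
  apply: cvgM; last first.
    by apply: continuous_comp; [exact: continuousN|exact: continuous_expR].
  apply: cvgM; last by apply: cvgV => //; rewrite gt_eqF// sqrtr_gt0.
  apply: (@continuous_comp _ _ _ Num.sqrt (fun y : R => y ^+ n)) => //.
  exact: exprn_continuous.
rewrite -ge0_integralZl//.
- rewrite [LHS]integral_mkcond; apply: eq_integral => s _.
  rewrite patchE; case: ifPn => [|s0].
    rewrite inE/= in_itv/= andbT => s0; rewrite ppow_pos// -!EFinM.
    by rewrite /G sqrtr_sqr gtr0_norm//; congr EFin; field; rewrite gt_eqF.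
  rewrite ppow_npos ?mul0e ?mule0// leNgt; apply: contra s0 => s0.
  by rewrite inE/= in_itv/= s0.
- apply: emeasurable_funM; apply/measurable_EFinP; first exact: measurable_ppow.
  exact: measurable_gauss_fun.
- by move=> s _; rewrite mule_ge0// lee_fin ?ppow_ge0 ?expR_ge0.
Qed.

End gamma.

(** * Spherical coordinates around an axis *)

Section axial.
Context {R : realType}.
Local Notation mu := (@lebesgue_measure R).
Local Notation RR := (measurableTypeR R).

(** The area of the unit sphere of (n+1)-dimensional space. *)
Definition sphere_area n : R :=
  2 * pi `^ (n.+1%:R / 2) / Defs.Gamma (n.+1%:R / 2).

(** The constant is determined by the Gaussian function: its integral is both a
    power of [Num.sqrt pi] and the constant times half a value of Gamma. That the
    product of two extended nonnegative numbers is finite and nonzero also shows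
    that both of them are. *)
Lemma ge0_integral_radial n (phi : RR -> \bar R) :
  measurable_fun setT phi -> (forall t, 0 <= phi t)%E ->
  (\int[@lebesgue_vec R n.+1]_z phi (sqn z) =
   (sphere_area n)%:E * \int[mu]_s ((ppow n s)%:E * phi (s ^+ 2)%R))%E.
Proof.
move=> mphi phi0; have [c c0 cE] := @radial_exists R n.
rewrite cE//; congr (_ * _)%E.
have mexp : measurable_fun setT (fun v : RR => (expR (- v))%:E).
  by apply/measurable_EFinP; apply: measurableT_comp.
have exp0 (v : RR) : (0 <= (expR (- v))%:E)%E by rewrite lee_fin expR_ge0.
have cJ := cE _ mexp exp0.
have {cJ} := etrans (esym (@gauss_lebesgue_vec R n.+1)) cJ.
have GE := @integral_gamma R n.
set J := (\int[mu]_s _)%E => cJ.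
have J0 : (0 <= J)%E.
  by apply: integral_ge0 => s _; rewrite mule_ge0// lee_fin ?ppow_ge0 ?expR_ge0.
have pi0 : 0 < Num.sqrt pi ^+ n.+1 :> R by rewrite exprn_gt0// sqrtr_gt0 pi_gt0.
have [Jr JE] : exists j : R, J = j%:E.
  move: J0 cJ; case: J => [j|_|//]; first by exists j.
  move: c0; rewrite le_eqVlt => /predU1P[<-|c_gt0].
    by rewrite mul0e => -[] /eqP; rewrite gt_eqF.
  by rewrite gt0_muley.
have Gr : Defs.Gamma (n.+1%:R / 2) = 2 * Jr.
  rewrite /Defs.Gamma /Rintegral.
  have -> : (\int[mu]_(t in `]0%R, +oo[)
    (t `^ (n.+1%:R / 2 - 1) * expR (- t))%:E = 2%:E * J)%E := GE.
  by rewrite JE.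
have Jr0 : 0 <= Jr by rewrite -lee_fin -JE.
rewrite /sphere_area Gr powR_half ?pi_ge0//.
move: cJ c0; rewrite JE; case: c {cE} => [c| |//].
  rewrite -EFinM => -[cJ] _; congr EFin; rewrite cJ.
  have Jr_neq0 : Jr != 0.
    by apply/eqP => Jr00; move: pi0; rewrite cJ Jr00 mulr0 ltxx.
  by field.
move: Jr0; rewrite le_eqVlt => /predU1P[<-|Jr_gt0].
  by rewrite mule0 => -[] /eqP; rewrite gt_eqF.
by rewrite gt0_mulye.
Qed.

(** Spherical coordinates around the axis spanned by [x]: here [r] is the
    distance to the origin and [u] the cotangent of the angle with the axis. *)
Lemma ge0_integral_axial n (x : 'RR[R]_n.+2) (K : RR * RR -> \bar R) :
  measurable_fun setT K -> (forall p, 0 <= K p)%E ->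
  (\int[lebesgue_tuple n.+2]_y K (dotp x y, sqn y) =
   (sphere_area n)%:E * \int[mu]_r ((ppow n.+1 r)%:E *
     \int[mu]_u (((hyp u)^-1 ^+ n.+2)%:E *
       K (Num.sqrt (sqn x) * (r * (u / hyp u)), r ^+ 2)%R)))%E.
Proof.
move=> mK K0; rewrite ge0_integral_dotp_sqn//.
pose K' (p : RR * RR) : \bar R := K (Num.sqrt (sqn x) * p.1, p.2).
have mK' : measurable_fun setT K' by rewrite /K'; meas.
pose F (p : RR * RR) : \bar R := K' (p.2, p.2 ^+ 2 + p.1).
have mF : measurable_fun setT F.
  by apply: (measurableT_comp mK'); apply: measurable_fun_pair => //; meas.
have mphi := measurable_integral2 mu mF (fun=> K0 _).
rewrite [LHS](ge0_integral_radial n mphi) => [|v]; last first.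
  by apply: integral_ge0 => t _; exact: K0.
congr (_ * _)%E; exact: (polar_plane n mK' (fun=> K0 _)).
Qed.

End axial.

(** * Finiteness of the integral in the constant [M3] *)

Section decay.
Context {R : realType}.
Local Notation mu := (@lebesgue_measure R).
Local Notation RR := (measurableTypeR R).

(** The integrand in the definition of [M3], for [c = m / pi ^+ 2]. *)
Definition decay (c : R) n (s : R) : R :=
  expR (- c * (s ^+ 2 / Num.sqrt (1 + s ^+ 2))) * s ^+ n.

Lemma continuous_decay c n : continuous (decay c n).
Proof.
move=> s; apply: cvgM; last exact: exprn_continuous.
apply: continuous_comp; last exact: continuous_expR.
apply: cvgM; first exact: cvg_cst.
by apply: cvgM; [exact: exprn_continuous|exact: continuous_hypV].
Qed.

Lemma exprn_le_expR (c s : R) k : 0 < c -> 0 <= s ->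
  s ^+ k <= k`!%:R / c ^+ k * expR (c * s).
Proof.
move=> c0 s0; have cs : 0 <= c * s by rewrite mulr_ge0// ltW.
have ck : 0 < c ^+ k by rewrite exprn_gt0.
rewrite mulrAC ler_pdivlMr// mulrC -exprMn.
case: k {ck} => [|k].
  by rewrite expr0 fact0 mul1r -expR0 ler_expR.
have := expR_ge1Dxn k cs => H; rewrite -ler_pdivrMl ?ltr0n ?fact_gt0//.
by apply: le_trans H; rewrite mulrC lerDr.
Qed.

(** Since [s ^+ 2 / Num.sqrt (1 + s ^+ 2) >= s - 1], the integrand is at most a
    multiple of [(1 + s ^+ 2)^-1]. Without finiteness the real-valued integral
    in [M3] would be zero. *)
Lemma integral_decay_lty (c : R) n : 0 < c ->
  (\int[mu]_(s in `[0%R, +oo[) (decay c n s)%:E < +oo)%E.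
Proof.
move=> c0.
pose C : R := expR c * (n`!%:R / c ^+ n + n.+2`!%:R / c ^+ n.+2).
have C0 : 0 <= C.
  by rewrite mulr_ge0 ?expR_ge0// addr_ge0// divr_ge0// exprn_ge0// ltW.
have le_decay s : 0 <= s -> decay c n s <= C * (oneDsqr s)^-1.
  move=> s0; rewrite /oneDsqr ler_pdivlMr ?ltr_pwDl ?sqr_ge0//.
  have h1 : s - 1 <= s ^+ 2 / Num.sqrt (1 + s ^+ 2).
    have h := hyp_gt0 s; have h2 := hyp2 s; rewrite -/(hyp s).
    rewrite ler_pdivlMr//.
    have hs : hyp s <= 1 + s.
      by rewrite -(@ler_pXn2r _ 2)// ?nnegrE ?(ltW h) ?addr_ge0// h2; nra.
    have [s1|s1] := leP s 1; first by nra.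
    by nra.
  have h2 : expR (- c * (s ^+ 2 / Num.sqrt (1 + s ^+ 2))) <=
            expR c * expR (- (c * s)).
    by rewrite -expRD ler_expR; nra.
  have hn := @exprn_le_expR c s n c0 s0.
  have hn2 := @exprn_le_expR c s n.+2 c0 s0.
  rewrite /decay; apply: (@le_trans _ _ (expR c * expR (- (c * s)) *
      (s ^+ n + s ^+ n.+2))).
    rewrite -[leLHS]mulrA; apply: ler_pM => //.
    - by rewrite mulr_ge0 ?exprn_ge0// addr_ge0// sqr_ge0.
    - by rewrite mulrDr mulr1 -exprD addn2.
  apply: (@le_trans _ _ (expR c * expR (- (c * s)) *
    ((n`!%:R / c ^+ n + n.+2`!%:R / c ^+ n.+2) * expR (c * s)))).
    by apply: ler_wpM2l; rewrite ?mulr_ge0 ?expR_ge0// mulrDl lerD.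
  by rewrite mulrACA -expRD addNr expR0 mulr1 lexx.
apply: (@le_lt_trans _ _
    (\int[mu]_(s in `[0%R, +oo[) (C%:E * (oneDsqr s)^-1%:E))%E).
  apply: ge0_le_integral => //.
  - move=> s; rewrite /= in_itv/= andbT => s0.
    by rewrite lee_fin mulr_ge0 ?expR_ge0 ?exprn_ge0.
  - apply/measurable_EFinP/measurable_funTS.
    exact: (continuous_measurable_fun (@continuous_decay c n)).
  - apply/measurable_EFinP/measurable_funTS/measurable_funM => //.
    exact: (continuous_measurable_fun (@continuous_oneDsqrV R)).
  - by move=> s; rewrite /= in_itv/= andbT => s0; rewrite lee_fin le_decay.
rewrite ge0_integralZl//.
- by rewrite integral0y_oneDsqr -EFinM ltry.
- apply/measurable_EFinP/measurable_funTS.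
  exact: (continuous_measurable_fun (@continuous_oneDsqrV R)).
Qed.

End decay.

(** * Excess length of a broken line as a function of its angle *)

Section jordan.
Context {R : realType}.

Lemma sin_le_id (t : R) : 0 <= t -> sin t <= t.
Proof.
rewrite le_eqVlt => /predU1P[<-|t0]; first by rewrite sin0.
have [] := @MVT R sin cos 0 t t0.
- by apply: continuous_subspaceT; exact: continuous_sin.
move=> x _; rewrite sin0 !subr0 => ->.
by rewrite -[leRHS]mul1r ler_wpM2r ?cos_le1// ltW.
Qed.

Lemma sqr_cos_piquarter : 2 * cos (pi / 4) ^+ 2 = 1 :> R.
Proof.
have := cos_mulr2n (pi / 4 : R).
rewrite (_ : pi / 4 *+ 2 = pi / 2); last by field.
by rewrite cos_pihalf => /eqP; rewrite eq_sym subr_eq0 -mulr_natl => /eqP.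
Qed.

(** Jordan's inequality up to the factor [Num.sqrt 2]: up to [pi / 4] by the mean
    value theorem, beyond [pi / 4] by monotonicity of the sine. *)
Lemma jordan_weak (t : R) : 0 <= t <= pi / 2 ->
  (2 * t / pi) ^+ 2 <= 2 * sin t ^+ 2.
Proof.
move=> /andP[t0 tpi]; have pi0 : 0 < pi :> R by exact: pi_gt0.
have c4 := sqr_cos_piquarter.
have s4 : 2 * sin (pi / 4) ^+ 2 = 1 :> R.
  by have := cos2Dsin2 (pi / 4 : R); lra.
have pi4 : 0 <= cos (pi / 4 : R) by apply: cos_ge0_pihalf; lra.
rewrite !expr_div_n ler_pdivrMr ?exprn_gt0//.
have [t4|t4] := leP t (pi / 4); last first.
  have st : sin (pi / 4) <= sin t.
    by rewrite ltW// ltr_sin ?in_itv/=//; lra.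
  have s0 : 0 <= sin (pi / 4 : R) by apply: sin_ge0_pi; lra.
  have : 1 <= 2 * sin t ^+ 2 by nra.
  have : 2 * t <= pi by lra.
  nra.
have st : t * cos (pi / 4) <= sin t.
  move: t0; rewrite le_eqVlt => /predU1P[<-|t0]; first by rewrite mul0r sin0.
  have [] := @MVT R sin cos 0 t t0.
  - by apply: continuous_subspaceT; exact: continuous_sin.
  move=> x; rewrite in_itv/= => /andP[x0 xt]; rewrite sin0 !subr0 => ->.
  rewrite mulrC ler_wpM2r// ?ltW//.
  by rewrite ltr_cos ?in_itv/=//; lra.
have pi2 := @pi_ge2 R.
have : t ^+ 2 <= 2 * sin t ^+ 2.
  have tc : 0 <= t * cos (pi / 4) by rewrite mulr_ge0.
  have : (t * cos (pi / 4)) ^+ 2 <= sin t ^+ 2.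
    by rewrite lerXn2r// nnegrE// (le_trans tc).
  by rewrite exprMn; nra.
move=> h; apply: (@le_trans _ _ (t ^+ 2 * pi ^+ 2)); last first.
  by rewrite ler_wpM2r// exprn_ge0// ltW.
rewrite exprMn mulrC ler_wpM2l ?sqr_ge0//.
by rewrite lerXn2r ?nnegrE// ltW.
Qed.

End jordan.

Section excess.
Context {R : realType}.

(** The angle of [0, pi] with cotangent [- u]. The sign makes it increase. *)
Definition arccotN (u : R) : R := pi / 2 + atan u.

Lemma arccotN_gt0 u : 0 < arccotN u.
Proof. by have := atan_gtNpi2 u; rewrite /arccotN; lra. Qed.

Lemma arccotN_ltpi u : arccotN u < pi.
Proof. by have := atan_ltpi2 u; rewrite /arccotN; lra. Qed.

Lemma cos_arccotN u : cos (arccotN u) = - (u / hyp u).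
Proof.
rewrite /arccotN addrC cosDpihalf; congr (- _).
have c0 : cos (atan u) != 0.
  by rewrite cos_atan invr_eq0; exact: hyp_neq0.
have := atanK u; rewrite /tan => /(canRL (mulfVK c0)) ->.
by rewrite cos_atan.
Qed.

Lemma sin_arccotN u : sin (arccotN u) = (hyp u)^-1.
Proof. by rewrite /arccotN addrC sinDpihalf cos_atan. Qed.

Lemma hypV_le_arccotN u : (hyp u)^-1 <= arccotN u.
Proof. by rewrite -sin_arccotN; exact/sin_le_id/ltW/arccotN_gt0. Qed.

Lemma sqr_arccotN_le u : arccotN u ^+ 2 / pi ^+ 2 <= 1 + u / hyp u.
Proof.
have h0 := arccotN_gt0 u; have hpi := arccotN_ltpi u.
rewrite -[u / _]opprK -cos_arccotN.
have -> : arccotN u = arccotN u / 2 *+ 2 by field.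
rewrite cos_mulr2n; set t := arccotN u / 2.
have /jordan_weak : 0 <= t <= pi / 2 by rewrite /t; apply/andP; split; lra.
have := cos2Dsin2 t.
rewrite -expr_div_n (_ : t *+ 2 / pi = 2 * t / pi) ?mulr_natl//.
by rewrite -mulr_natl; lra.
Qed.

(** After squaring, the claim is [(q / s) ^+ 2 <= 2 * a * (q - q / s)], where
    [q / s] is at most half of [s - 1]. *)
Lemma chord_le (a q s : R) : 1 <= a -> 1 <= s -> 0 <= q ->
  q * 4 <= s ^+ 2 - 1 -> a + q / s <= Num.sqrt (a ^+ 2 + 2 * a * q).
Proof.
move=> a1 s1 q0 qs.
have s0 : 0 < s by lra.
have qs0 : 0 <= q / s by rewrite divr_ge0// ltW.
rewrite -(@ler_pXn2r _ 2)// ?nnegrE ?sqrtr_ge0//; last by lra.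
rewrite sqr_sqrtr; last by rewrite addr_ge0 ?sqr_ge0// !mulr_ge0//; lra.
have qE : q = q / s * s by rewrite divfK// gt_eqF.
set p := q / s in qs0 qE *; rewrite qE in qs *.
have h1 : 2 * p <= s - 1 by nra.
have h2 : p * (2 * p) <= p * (s - 1) by rewrite ler_wpM2l.
have h3 : p * (s - 1) <= a * (p * (s - 1)).
  by rewrite ler_peMl// mulr_ge0//; lra.
have h4 : 0 <= p * p by rewrite mulr_ge0.
by rewrite -subr_ge0; lra.
Qed.

(** With [theta = arccotN u], the square root on the right is the distance from a
    point at distance [r] from the origin to one at distance [rho], in directions
    that make the angle [theta]. Its radicand is
    [(r - rho) ^+ 2 + 2 * r * rho * (1 - cos theta)], and
    [1 - cos theta >= theta ^+ 2 / pi ^+ 2]. *)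
Lemma distance_excess (r rho u t : R) : 0 < rho -> 1 <= r - rho ->
  t = Num.sqrt (r * rho / (r - rho)) * arccotN u ->
  pi ^- 2 * (t ^+ 2 / Num.sqrt (1 + t ^+ 2)) <=
  Num.sqrt (r ^+ 2 + rho ^+ 2 + 2 * (r * (rho * (u / hyp u)))) + rho - r.
Proof.
move=> rho0; set a := r - rho => a1 tE.
have r0 : 0 < r by move: a1; rewrite /a; lra.
have t2 : t ^+ 2 = r * rho / a * arccotN u ^+ 2.
  by rewrite tE exprMn sqr_sqrtr// divr_ge0 ?mulr_ge0//; lra.
have pi0 : 0 < pi :> R by exact: pi_gt0.
pose q := t ^+ 2 / pi ^+ 2; pose s := Num.sqrt (1 + t ^+ 2).
have s2 : s ^+ 2 = 1 + t ^+ 2 by exact: hyp2.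
have s1 : 1 <= s.
  by rewrite -(@ler_pXn2r _ 2)// ?nnegrE ?sqrtr_ge0// s2 expr1n lerDl sqr_ge0.
have q0 : 0 <= q by rewrite divr_ge0 ?sqr_ge0.
have q4 : q * 4 <= s ^+ 2 - 1.
  rewrite s2 addrC addKr /q mulrAC ler_pdivrMr ?exprn_gt0//.
  rewrite ler_wpM2l ?sqr_ge0//; have := @pi_ge2 R; nra.
have := chord_le a1 s1 q0 q4.
have : Num.sqrt (a ^+ 2 + 2 * a * q) <=
    Num.sqrt (r ^+ 2 + rho ^+ 2 + 2 * (r * (rho * (u / hyp u)))).
  apply: ler_wsqrtr.
  have -> : 2 * a * q = 2 * (r * rho) * (arccotN u ^+ 2 / pi ^+ 2).
    by rewrite /q t2; field; rewrite !gt_eqF//; lra.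
  have := sqr_arccotN_le u; set X := _ / _; set Y := u / _ => XY.
  have rr : 0 <= r * rho by rewrite mulr_ge0// ltW.
  have := ler_wpM2l rr XY; rewrite /a; nra.
have -> : pi ^- 2 * (t ^+ 2 / Num.sqrt (1 + t ^+ 2)) = q / s.
  by rewrite /q /s mulrA [_ * t ^+ 2]mulrC.
rewrite /a; lra.
Qed.

End excess.

(** * The angular integral *)

Section angular.
Context {R : realType}.
Local Notation mu := (@lebesgue_measure R).
Local Notation RR := (measurableTypeR R).

Lemma integral_setT_le (h : R -> R) (C : \bar R) :
  continuous h -> (forall u, 0 <= h u) ->
  (forall j : nat, \int[mu]_(u in `[(- j%:R)%R, (j%:R)%R]) (h u)%:E <= C)%E ->
  (\int[mu]_u (h u)%:E <= C)%E.
Proof.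
move=> ch h0 hC.
have cup : \bigcup_(j : nat) `[- j%:R : R, j%:R]%classic = setT.
  rewrite -subTset => u _; exists (Num.truncn `|u|).+1 => //=.
  by rewrite in_itv/= -ler_norml ltW// truncnS_gt.
have cv : (\int[mu]_(u in `[(- j%:R)%R, (j%:R)%R]) (h u)%:E @[j --> \oo] -->
    \int[mu]_u (h u)%:E)%E.
  rewrite -cup; apply: ge0_nondecreasing_set_cvg_integral => //.
  - apply/nondecreasing_seqP => j; rewrite subsetEset => u /=.
    rewrite !in_itv/= => /andP[ju uj]; apply/andP; split.
      by apply: le_trans ju; rewrite lerN2 ler_nat.
    by apply: le_trans uj _; rewrite ler_nat.
  - move=> j; apply/measurable_EFinP/measurable_funTS.
    exact: continuous_measurable_fun.
  - by move=> j u _; rewrite lee_fin.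
rewrite -(cvg_lim _ cv)//; apply: lime_le; first by apply/cvg_ex; eexists; exact: cv.
by apply: nearW.
Qed.

(** The substitution [s = k * arccotN u]; only an inequality, because the range
    of [arccotN] is bounded. *)
Lemma integral_arccotN_subst (k : R) (psi : R -> R) : 0 < k ->
  continuous psi -> (forall s, 0 <= s -> 0 <= psi s) ->
  (\int[mu]_u (psi (k * arccotN u) * (k * (hyp u)^-1 ^+ 2))%R%:E <=
   \int[mu]_(s in `[0%R, +oo[) (psi s)%:E)%E.
Proof.
move=> k0 cpsi psi0.
have dT : derive1 (fun u : R => k * arccotN u) = (fun u => k * (hyp u)^-1 ^+ 2).
  apply/funext => u; rewrite derive1E.
  have H : is_derive u 1 (fun u : R => k * arccotN u) (k *: (0 + (1 + u ^+ 2)^-1)).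
    by apply: is_deriveZ; apply: is_deriveD.
  by rewrite derive_val add0r exprVn hyp2.
have cT : continuous (fun u : R => k * arccotN u).
  move=> u; apply: cvgM; first exact: cvg_cst.
  by apply: cvgD; [exact: cvg_cst|exact: continuous_atan].
have dTr u : derivable (fun u : R => k * arccotN u) u 1.
  have H : is_derive u 1 (fun u : R => k * arccotN u) (k *: (0 + (1 + u ^+ 2)^-1)).
    by apply: is_deriveZ; apply: is_deriveD.
  exact: ex_derive.
have cdT : continuous (fun u : R => k * (hyp u)^-1 ^+ 2).
  move=> u; apply: cvgM; first exact: cvg_cst.
  apply: (@continuous_comp _ _ _ (fun u : R => (hyp u)^-1) (fun y : R => y ^+ 2)).
    exact: continuous_hypV.
  exact: exprn_continuous.
have T0 u : 0 <= k * arccotN u by rewrite mulr_ge0// ltW// arccotN_gt0.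
apply: integral_setT_le.
- move=> u; apply: cvgM; last exact: cdT.
  apply: (@continuous_comp _ _ _ (fun u : R => k * arccotN u) psi).
    exact: cT.
  exact: cpsi.
- by move=> u; rewrite !mulr_ge0 ?exprn_ge0 ?invr_ge0 ?psi0// ltW// hyp_gt0.
move=> j.
have := @integration_by_substitution_increasing R (fun u : R => k * arccotN u)
  psi (- j%:R) j%:R.
rewrite dT => <-.
- apply: ge0_subset_integral => //.
  + apply/measurable_EFinP/measurable_funTS.
    exact: continuous_measurable_fun.
  + by move=> s; rewrite /= in_itv/= andbT lee_fin => /psi0.
  + move=> s; rewrite /= !in_itv/= andbT => /andP[+ _].
    exact: le_trans.
- by rewrite (@le_trans _ _ 0)// oppr_le0.
- by move=> u v _ _ uv; rewrite ltr_pM2l// ltrD2l lt_atan.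
- by move=> u _; exact: cdT.
- by apply/cvg_ex; eexists; apply: cvg_at_right_filter; exact: cdT.
- by apply/cvg_ex; eexists; apply: cvg_at_left_filter; exact: cdT.
- split; first by move=> u _; exact: dTr.
    by apply: cvg_at_right_filter; exact: cT.
  by apply: cvg_at_left_filter; exact: cT.
- exact: continuous_subspaceT.
Qed.

Lemma measurable_sqrt : measurable_fun setT (@Num.sqrt R : RR -> RR).
Proof. exact: (continuous_measurable_fun (@sqrt_continuous R)). Qed.

Lemma hypN u : hyp (- u) = hyp u :> R.
Proof. by rewrite /hyp sqrrN. Qed.

(** The sine of the angle [theta] is bounded by [theta], the exponent by
    [distance_excess], and the new variable is [theta] scaled by [k]. *)
Lemma angular_integral_le n (m r rho : R) : 0 < m -> 0 < rho -> 1 <= r - rho ->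
  (\int[mu]_u ((hyp u)^-1 ^+ n.+2 * expR (- m *
      (Num.sqrt (r ^+ 2 + rho ^+ 2 - 2 * (r * (rho * (u / hyp u)))) + rho - r)))%R%:E
   <= ((Num.sqrt (r * rho / (r - rho)))^-1 ^+ n.+1)%:E *
      \int[mu]_(s in `[0%R, +oo[) (decay (m / pi ^+ 2) n s)%:E)%E.
Proof.
move=> m0 rho0 a1; set k := Num.sqrt (r * rho / (r - rho)).
have r0 : 0 < r by lra.
have k0 : 0 < k by rewrite sqrtr_gt0 divr_gt0 ?mulr_gt0//; lra.
have pi0 : 0 < pi :> R by exact: pi_gt0.
pose h (u : R) : R := (hyp u)^-1 ^+ n.+2 * expR (- m *
  (Num.sqrt (r ^+ 2 + rho ^+ 2 - 2 * (r * (rho * (u / hyp u)))) + rho - r)).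
have h0 u : 0 <= h u.
  by rewrite mulr_ge0 ?expR_ge0// exprn_ge0// invr_ge0 ltW// hyp_gt0.
have mh : measurable_fun setT (fun u : RR => (h u)%:E).
  apply/measurable_EFinP; apply: measurable_funM; first by meash.
  apply: (measurableT_comp (@measurable_expR R)).
  apply: measurable_funM => //; apply: measurable_funB => //.
  apply: measurable_funD => //.
  apply: (measurableT_comp measurable_sqrt).
  apply: measurable_funB => //; do 3 apply: measurable_funM => //.
  by meash.
(* Reflecting [u] turns the cosine [u / hyp u] into that of [arccotN u]. *)
have N10 : (-1 : R) != 0 by rewrite oppr_eq0 oner_eq0.
rewrite (ge0_integral_affine 0 N10 mh) => [|u]; last by rewrite lee_fin.
rewrite normrN normr1 mul1e.
have cd := @continuous_decay R (m / pi ^+ 2) n.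
have d0 s : 0 <= s -> 0 <= decay (m / pi ^+ 2) n s.
  by move=> s0; rewrite mulr_ge0 ?expR_ge0// exprn_ge0.
have := integral_arccotN_subst k0 cd d0 => sub.
have kV0 : 0 <= k^-1 ^+ n.+1 by rewrite exprn_ge0// invr_ge0 ltW.
apply: le_trans (lee_wpmul2l _ sub); last by rewrite lee_fin.
have mg : measurable_fun setT (fun u : RR =>
    (decay (m / pi ^+ 2) n (k * arccotN u) * (k * (hyp u)^-1 ^+ 2))%:E).
  apply/measurable_EFinP; apply: measurable_funM; last by meash.
  apply: (measurableT_comp (continuous_measurable_fun cd)).
  apply: measurable_funM => //; apply: measurable_funD => //.
  exact: (continuous_measurable_fun (@continuous_atan R)).
rewrite -ge0_integralZl//; last first.
  move=> u _; have t0 : 0 <= arccotN u by rewrite ltW// arccotN_gt0.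
  have hV0 : 0 <= (hyp u)^-1 by rewrite invr_ge0 ltW// hyp_gt0.
  have k00 := ltW k0.
  rewrite lee_fin; apply: mulr_ge0; first by apply: d0; exact: mulr_ge0.
  by rewrite mulr_ge0 ?exprn_ge0.
apply: ge0_le_integral => //.
- by move=> u _; rewrite lee_fin.
- apply: (measurableT_comp mh); exact: measurable_affine.
- exact: measurable_funeM.
move=> u _; rewrite -EFinM lee_fin addr0 mulN1r /h hypN.
have -> : r ^+ 2 + rho ^+ 2 - 2 * (r * (rho * (- u / hyp u))) =
          r ^+ 2 + rho ^+ 2 + 2 * (r * (rho * (u / hyp u))).
  by rewrite mulNr !mulrN opprK.
rewrite /decay.
set t := k * arccotN u.
have excess := @distance_excess R r rho u t rho0 a1 erefl.
set X := Num.sqrt _ + rho - r in excess *.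
set Y := t ^+ 2 / _ in excess *.
have hV0 : 0 <= (hyp u)^-1 by rewrite invr_ge0 ltW// hyp_gt0.
have -> : k^-1 ^+ n.+1 * (expR (- (m / pi ^+ 2) * Y) * t ^+ n *
    (k * (hyp u)^-1 ^+ 2)) =
  (arccotN u ^+ n * (hyp u)^-1 ^+ 2) * expR (- (m / pi ^+ 2) * Y).
  rewrite /t exprMn exprS exprVn.
  by field; rewrite hyp_neq0 expf_neq0// gt_eqF.
apply: ler_pM; rewrite ?expR_ge0 ?exprn_ge0//.
  rewrite -[n.+2]addn2 exprD ler_wpM2r ?exprn_ge0//.
  by rewrite lerXn2r ?nnegrE ?hypV_le_arccotN// ltW// arccotN_gt0.
by rewrite ler_expR !mulNr lerN2 -mulrA ler_pM2l.
Qed.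

Lemma M3_ge n (m : R) : 0 < m ->
  sphere_area n * fine (\int[mu]_(s in `[0%R, +oo[) (decay (m / pi ^+ 2) n s)%:E)%E
  <= M3 n.+2 m.
Proof.
move=> m0; rewrite /M3 le_max; apply/orP; right.
have -> : (n.+2%:R - 1) / 2 = n.+1%:R / 2 :> R by rewrite -[n.+2%:R]natr1 addrK.
rewrite /sphere_area; set A := 2 * _ / _.
by rewrite (_ : (n.+2 - 2)%N = n) ?lexx// -addn2 addnK.
Qed.

Lemma sphere_area_ge0 n : 0 <= sphere_area n :> R.
Proof.
rewrite divr_ge0 ?mulr_ge0 ?powR_ge0//; apply: Rintegral_ge0 => t _.
by rewrite mulr_ge0 ?powR_ge0 ?expR_ge0.
Qed.

Lemma M3_ge1 n (m : R) : 1 <= M3 n m.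
Proof. by rewrite le_max lexx. Qed.

(** The factor [rho ^+ n.+1] of the area element and the scaling of the angle
    combine to the power of [(r - rho) * rho / r] in the definition of the
    functions [Hfun], and [M3] is what remains. *)
Lemma angular_integral_le_M3 n (m r rho : R) : 0 < m -> 0 < rho -> 1 <= r - rho ->
  ((sphere_area n * rho ^+ n.+1)%:E *
   \int[mu]_u ((hyp u)^-1 ^+ n.+2 * expR (- m *
      (Num.sqrt (r ^+ 2 + rho ^+ 2 - 2 * (r * (rho * (u / hyp u)))) + rho - r)))%R%:E
   <= (M3 n.+2 m * (Num.sqrt (r - rho) * Num.sqrt rho / Num.sqrt r) ^+ n.+1)%:E)%E.
Proof.
move=> m0 rho0 a1; have r0 : 0 < r by lra.
have a0 : 0 < r - rho by lra.
have A0 := sphere_area_ge0 n.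
have rn0 : 0 <= rho ^+ n.+1 by rewrite exprn_ge0// ltW.
have mpi : 0 < m / pi ^+ 2 by rewrite divr_gt0// exprn_gt0// pi_gt0.
have Plty := @integral_decay_lty R _ n mpi.
have P0 : (0 <= \int[mu]_(s in `[0%R, +oo[) (decay (m / pi ^+ 2) n s)%:E)%E.
  apply: integral_ge0 => s; rewrite /= in_itv/= andbT => s0.
  by rewrite lee_fin mulr_ge0 ?expR_ge0// exprn_ge0.
have := M3_ge n m0; have := angular_integral_le n m0 rho0 a1.
move: P0 Plty; set P := (\int[mu]_(s in `[0%R, +oo[) _)%E => P0 Plty.
have Pfin : P \is a fin_num by rewrite ge0_fin_numE.
rewrite -(fineK Pfin) fineK// => angle AP.
apply: le_trans (lee_wpmul2l _ angle) _; first by rewrite lee_fin mulr_ge0.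
rewrite -(fineK Pfin) -!EFinM lee_fin.
have -> : sphere_area n * rho ^+ n.+1 *
    ((Num.sqrt (r * rho / (r - rho)))^-1 ^+ n.+1 * fine P) =
  (sphere_area n * fine P) *
    (rho * (Num.sqrt (r * rho / (r - rho)))^-1) ^+ n.+1.
  by rewrite exprMn; ring.
have -> : rho * (Num.sqrt (r * rho / (r - rho)))^-1 =
    Num.sqrt (r - rho) * Num.sqrt rho / Num.sqrt r.
  rewrite sqrtrM ?mulr_ge0 ?ltW// sqrtrM ?ltW// sqrtrV ?ltW//.
  rewrite -{1}(sqr_sqrtr (ltW rho0)).
  by field; rewrite !gt_eqF ?sqrtr_gt0.
by rewrite ler_wpM2r// exprn_ge0// divr_ge0 ?mulr_ge0 ?sqrtr_ge0.
Qed.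

End angular.

(** * Euclidean geometry of tuples *)

Section geometry.
Context {R : realType}.

Lemma dotp_behead n (x y : 'RR[R]_n.+1) :
  dotp x y = (thead x : R) * thead y + dotp [tuple of behead x] [tuple of behead y].
Proof. by rewrite [in LHS](tuple_eta y) -dotp_cons. Qed.

Lemma cauchy_schwarz n (x y : 'RR[R]_n) :
  dotp x y <= Num.sqrt (sqn x) * Num.sqrt (sqn y).
Proof.
elim: n x y => [|n IH] x y.
  by rewrite /dotp big_ord0 mulr_ge0 ?sqrtr_ge0.
rewrite dotp_behead; set a : R := thead x; set b : R := thead y.
have := IH [tuple of behead x] [tuple of behead y].
rewrite (sqn_behead x) (sqn_behead y) -/a -/b.
have := sqn_ge0 [tuple of behead x]; have := sqn_ge0 [tuple of behead y].
set X := sqn _; set Y := sqn _; set D := dotp _ _ => X0 Y0 DXY.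
have p2 : Num.sqrt Y ^+ 2 = Y by rewrite sqr_sqrtr.
have q2 : Num.sqrt X ^+ 2 = X by rewrite sqr_sqrtr.
move: p2 q2 DXY (sqrtr_ge0 X) (sqrtr_ge0 Y).
set p := Num.sqrt Y; set q := Num.sqrt X => p2 q2 Dpq q0 p0.
have a2Y : 0 <= a ^+ 2 + Y by rewrite addr_ge0 ?sqr_ge0.
have b2X : 0 <= b ^+ 2 + X by rewrite addr_ge0 ?sqr_ge0.
apply: (@le_trans _ _ (a * b + p * q)); first by rewrite lerD2l.
rewrite -sqrtrM// (le_trans (ler_norm _))// -sqrtr_sqr ler_wsqrtr//.
rewrite -p2 -q2 -subr_ge0 (_ : _ - _ = (a * q - b * p) ^+ 2) ?sqr_ge0//; ring.
Qed.

Lemma sqn_subt n (x y : 'RR[R]_n) :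
  sqn (subt x y) = sqn x + sqn y - 2 * dotp x y.
Proof.
rewrite /sqn /dotp mulr_sumr -big_split -sumrB/=; apply: eq_bigr => i _.
by rewrite tnth_mktuple; ring.
Qed.

Lemma enorm_triangle n (x y : 'RR[R]_n) : enorm x <= enorm y + enorm (subt x y).
Proof.
have sxy := sqn_subt x y; have CS := cauchy_schwarz x y.
rewrite /enorm -!/(sqn _); move: sxy CS.
move: (sqrtr_ge0 (sqn (subt x y))) (sqrtr_ge0 (sqn x)) (sqrtr_ge0 (sqn y)).
move: (sqr_sqrtr (sqn_ge0 (subt x y))) (sqr_sqrtr (sqn_ge0 x)).
move: (sqr_sqrtr (sqn_ge0 y)).
set p := Num.sqrt (sqn x); set q := Num.sqrt (sqn y).
set s := Num.sqrt (sqn (subt x y)).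
move=> q2 p2 s2 s0 p0 q0 sE CS; have [//|lt_s] := leP p (q + s).
have : s ^+ 2 < (p - q) ^+ 2 by rewrite ltr_pXn2r ?nnegrE//; lra.
nra.
Qed.

End geometry.

(** * Measurability of the functions [Hfun] *)

Section measurability.
Context {R : realType}.
Local Notation mu := (@lebesgue_measure R).
Local Notation RR := (measurableTypeR R).

(** The integral of a nonnegative function is a supremum over the simple functions
    below it, hence monotone without measurability; the functions [hfun] can
    then be bounded without a proof that they are measurable. *)
Lemma ge0_le_integralT d (T : measurableType d) (nu : {measure set T -> \bar R})
    (f1 f2 : T -> \bar R) : (forall x, 0 <= f1 x)%E ->
  (forall x, f1 x <= f2 x)%E -> (\int[nu]_x f1 x <= \int[nu]_x f2 x)%E.
Proof.
move=> f10 f12; have f20 x : (0 <= f2 x)%E by exact: le_trans (f10 x) (f12 x).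
rewrite !ge0_integralTE//; apply: le_ereal_sup => _ /= [h hf1 <-].
by exists h => // x; exact: le_trans (hf1 x) (f12 x).
Qed.

(** Superlevel sets are intervals. *)
Lemma nonincreasing_emeasurable (f : RR -> \bar R) :
  (forall r s, (r <= s)%R -> f s <= f r)%E -> measurable_fun setT f.
Proof.
move=> fni; apply: (measurability _ (ErealGenOInfty.measurableE R)).
move=> /= _ [_ [a ->]] <-; rewrite setTI preimage_itvoy.
apply: is_interval_measurable => s t /= fs ft u /andP[_ ut].
exact: lt_le_trans ft (fni _ _ ut).
Qed.

Lemma lte_inveC (a : R) (y : \bar R) : 0 <= a -> (0 <= y)%E ->
  (a%:E < y^-1)%E = (y < (a%:E)^-1)%E.
Proof.
move=> a0; case: y => [y| |//].
  rewrite lee_fin => y0; rewrite !inver.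
  have [->|yn0] := eqVneq y 0; have [->|an0] := eqVneq a 0; rewrite ?ltry//.
  - by rewrite lte_fin invr_gt0 lt_def an0 a0.
  - by rewrite lte_fin invr_gt0 lt_def yn0 y0.
  - have yp : 0 < y by rewrite lt_def yn0.
    have ap : 0 < a by rewrite lt_def an0.
    by rewrite !lte_fin -[a in a < _]invrK ltf_pV2// posrE// invr_gt0.
by move=> _; rewrite invey lte_fin ltNge a0 ltNge leey.
Qed.

Lemma emeasurable_inve d (T : measurableType d) (f : T -> \bar R) :
  measurable_fun setT f -> (forall t, 0 <= f t)%E ->
  measurable_fun setT (fun t => (f t)^-1)%E.
Proof.
move=> mf f0; apply: (measurability _ (ErealGenOInfty.measurableE R)).
move=> /= _ [_ [a ->]] <-; rewrite preimage_itvoy.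
have [a0|a0] := ltP a 0.
  rewrite (_ : [set t | _] = setT) ?setTI//.
  apply/seteqP; split=> // t _ /=; apply: (@lt_le_trans _ _ 0%E).
    by rewrite lte_fin.
  by rewrite inve_ge0.
rewrite (_ : [set t | _] = [set t | f t < (a%:E)^-1]%E); last first.
  by apply/seteqP; split=> t /=; rewrite lte_inveC.
exact: emeasurable_fun_infty_o.
Qed.

End measurability.

Section Hfun.
Context {R : realType}.
Local Notation mu := (@lebesgue_measure R).
Local Notation RR := (measurableTypeR R).

Lemma HfunSS d (g : R -> \bar R) n r : 2 < r ->
  (Hfun d g n.+2 r = (g r * (r `^ ((d%:R - 1) / 2))%:E)^-1 *
   \int[mu]_(rho in `[1%R, (r - 1)%R])
     (g (r - rho)%R * ((r - rho) `^ ((d%:R - 1) / 2))%:E * g rho *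
      (rho `^ ((d%:R - 1) / 2))%:E * Hfun d g n.+1 rho))%E.
Proof. by move=> r2; rewrite /= leNgt r2. Qed.

(** Lets [g] be redefined on the negative reals, so as to be monotone, hence
    measurable, on the whole line. *)
Lemma eq_Hfun d (g g' : R -> \bar R) : (forall r, 0 <= r -> g r = g' r) ->
  forall n r, Hfun d g n r = Hfun d g' n r.
Proof.
move=> gg'; elim=> [//|[//|n] IH] r.
have [r2|r2] := leP r 2; first by rewrite /= r2.
rewrite (HfunSS d g n r2) (HfunSS d g' n r2).
rewrite (gg' r); last by lra.
apply: congr1; apply: eq_integral => rho rho_in.
have /andP[r1 rr] : 1 <= rho <= r - 1 by move: rho_in; rewrite inE/= in_itv.
rewrite (gg' rho); last by lra.
rewrite (gg' (r - rho)); last by lra.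
by rewrite IH.
Qed.

Lemma Hfun_ge0 d (g : R -> \bar R) : (forall r, 0 <= g r)%E ->
  forall n r, (0 <= Hfun d g n r)%E.
Proof.
move=> g0; elim=> [|[|n] IH] r /=; rewrite ?lee_fin//.
case: ifPn => [//|_]; apply: mule_ge0.
  by rewrite inve_ge0 mule_ge0// lee_fin powR_ge0.
by apply: integral_ge0 => rho _; rewrite !mule_ge0// lee_fin powR_ge0.
Qed.

Lemma measurable_Hfun d (g : R -> \bar R) : measurable_fun setT (g : RR -> \bar R) ->
  (forall r, 0 <= g r)%E -> forall n, measurable_fun setT (Hfun d g n : RR -> \bar R).
Proof.
move=> mg g0; elim=> [|[|n] IH] /=; try exact: measurable_cst.
set a : R := (d%:R - 1) / 2.
have mp : measurable_fun setT (fun r : RR => (r `^ a)%:E).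
  by apply/measurable_EFinP; exact: measurable_powR.
apply: measurable_fun_ifT => //; first exact: measurable_fun_ler.
apply: emeasurable_funM.
  apply: emeasurable_inve; first exact: emeasurable_funM.
  by move=> t; rewrite mule_ge0// lee_fin powR_ge0.
pose F (p : RR * RR) : \bar R :=
  if (1 <= p.2) && (p.2 <= p.1 - 1) then
    (g (p.1 - p.2)%R * ((p.1 - p.2) `^ a)%:E * g p.2 * (p.2 `^ a)%:E *
      Hfun d g n.+1 p.2)%E
  else 0%E.
have mF : measurable_fun setT F.
  have md : measurable_fun setT (fun p : RR * RR => p.1 - p.2 : RR) by meas.
  apply: measurable_fun_ifT => //.
    apply: measurable_and; apply: measurable_fun_ler => //.
    exact: measurable_funB.
  apply: emeasurable_funM; last by apply: (measurableT_comp IH).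
  apply: emeasurable_funM; last by apply: (measurableT_comp mp).
  apply: emeasurable_funM; last by apply: (measurableT_comp mg).
  apply: emeasurable_funM; last by apply: (measurableT_comp mp).
  by apply: (measurableT_comp mg).
have F0 p : (0 <= F p)%E.
  rewrite /F; case: ifP => // _; rewrite !mule_ge0 ?lee_fin ?powR_ge0//.
  exact: Hfun_ge0.
apply: eq_measurable_fun (measurable_integral2 mu mF F0) => r _.
rewrite [RHS]integral_mkcond; apply: eq_integral => rho _.
rewrite patchE /F /=; case: ifPn => h; first by rewrite mem_set//= in_itv.
by rewrite memNset//= in_itv/=; exact/negP.
Qed.

End Hfun.

(** * Convolution over a spherical shell *)

Section convolution.
Context {R : realType}.
Local Notation mu := (@lebesgue_measure R).
Local Notation RR := (measurableTypeR R).

(** The integral in spherical coordinates around [x], with the angular integral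
    estimated for each value of [rho = enorm y]. *)
Lemma integral_shell_le n (m r : R) (x : 'RR[R]_n.+2) (Phi : RR -> \bar R) :
  0 < m -> 0 < r -> enorm x = r -> measurable_fun setT Phi ->
  (forall t, 0 <= Phi t)%E ->
  (forall t, ~~ (1 <= t <= r - 1) -> Phi t = 0%E) ->
  (\int[lebesgue_tuple n.+2]_y (Phi (enorm y) *
     (expR (- m * (Num.sqrt (r ^+ 2 + sqn y - 2 * dotp x y) + enorm y - r)))%:E) <=
   (M3 n.+2 m / Num.sqrt r ^+ n.+1)%:E * \int[mu]_(rho in `[1%R, (r - 1)%R])
     (Phi rho * ((Num.sqrt (r - rho) * Num.sqrt rho) ^+ n.+1)%:E))%E.
Proof.
move=> m0 r0 xr mPhi Phi0 Phi_out.
pose e (p q : R) : R :=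
  expR (- m * (Num.sqrt (r ^+ 2 + q - 2 * p) + Num.sqrt q - r)).
pose K (p : RR * RR) : \bar R := (Phi (Num.sqrt p.2) * (e p.1 p.2)%:E)%E.
have me d (T : measurableType d) (f h : T -> RR) :
    measurable_fun setT f -> measurable_fun setT h ->
    measurable_fun setT (fun u => (e (f u) (h u))%:E).
  move=> mf mh; apply/measurable_EFinP.
  apply: (measurableT_comp (@measurable_expR R)).
  apply: measurable_funM => //; apply: measurable_funB => //.
  apply: measurable_funD; last exact: (measurableT_comp measurable_sqrt).
  apply: (measurableT_comp measurable_sqrt); apply: measurable_funB.
    exact: measurable_funD.
  exact: measurable_funM.
have e0 p q : (0 <= (e p q)%:E)%E by rewrite lee_fin expR_ge0.
have mK : measurable_fun setT K.
  apply: emeasurable_funM; last exact: me.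
  apply: (measurableT_comp mPhi); exact: (measurableT_comp measurable_sqrt).
have K0 p : (0 <= K p)%E by rewrite mule_ge0.
have M0 : 0 <= M3 n.+2 m / Num.sqrt r ^+ n.+1.
  rewrite divr_ge0 ?exprn_ge0 ?sqrtr_ge0//.
  by rewrite (le_trans _ (M3_ge1 _ _)).
pose W (t : R) : R := (Num.sqrt (r - t) * Num.sqrt t) ^+ n.+1.
have W0 t : 0 <= W t by rewrite exprn_ge0// mulr_ge0 ?sqrtr_ge0.
have mW : measurable_fun setT (fun t : RR => (W t)%:E).
  apply/measurable_EFinP; apply: measurable_funX; apply: measurable_funM.
    by apply: (measurableT_comp measurable_sqrt); exact: measurable_funB.
  exact: measurable_sqrt.
have mPW : measurable_fun setT (fun t : RR => Phi t * (W t)%:E)%E.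
  exact: emeasurable_funM.
have axial := ge0_integral_axial x mK K0.
rewrite [leLHS]axial.
pose G (p : RR * RR) : \bar R := (((hyp p.2)^-1 ^+ n.+2)%:E *
  K (Num.sqrt (sqn x) * (p.1 * (p.2 / hyp p.2)), p.1 ^+ 2)%R)%E.
have mG : measurable_fun setT G.
  apply: emeasurable_funM; first by apply/measurable_EFinP; meash.
  by meash.
have hV0 u : 0 <= (hyp u)^-1 :> R by rewrite invr_ge0 ltW// hyp_gt0.
have G0 p : (0 <= G p)%E by rewrite mule_ge0// lee_fin exprn_ge0.
have mpG : measurable_fun setT (fun t : RR =>
    (ppow n.+1 t)%:E * \int[mu]_u G (t, u))%E.
  apply: emeasurable_funM; last exact: measurable_integral2.
  by apply/measurable_EFinP; exact: measurable_ppow.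
have pG0 t : (0 <= (ppow n.+1 t)%:E * \int[mu]_u G (t, u))%E.
  by rewrite mule_ge0// ?lee_fin ?ppow_ge0//; apply: integral_ge0.
have A0 : (0 <= (sphere_area n : R)%:E)%E by rewrite lee_fin sphere_area_ge0.
have sZ := ge0_integralZl mu measurableT mpG (fun t _ => pG0 t) A0.
rewrite -[leLHS]sZ.
rewrite -[leRHS]ge0_integralZl//; last 2 first.
- exact: measurable_funTS.
- by move=> t _; rewrite mule_ge0// lee_fin.
rewrite [leRHS]integral_mkcond.
apply: ge0_le_integralT => [t|t]; first by rewrite mule_ge0.
rewrite patchE; have [/[dup] t_in /andP[t1 tr]|t_out] := boolP (1 <= t <= r - 1);
    last first.
  rewrite memNset; last by rewrite /= in_itv/=; exact/negP.
  have [t0|t0] := leP t 0; first by rewrite ppow_npos// mul0e mule0.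
  rewrite integral0_eq ?mule0// => u _.
  by rewrite /G /K /= sqrtr_sqr gtr0_norm// Phi_out// mul0e mule0.
rewrite mem_set; last by rewrite /= in_itv.
have t0 : 0 < t by lra.
have a1 : 1 <= r - t by lra.
rewrite ppow_pos//.
have xr' : Num.sqrt (sqn x) = r := xr.
pose E (u : R) : R := (hyp u)^-1 ^+ n.+2 * expR (- m *
      (Num.sqrt (r ^+ 2 + t ^+ 2 - 2 * (r * (t * (u / hyp u)))) + t - r)).
have E0 u : 0 <= E u by rewrite mulr_ge0 ?expR_ge0 ?exprn_ge0.
have mE : measurable_fun setT (fun u : RR => (E u)%:E).
  rewrite (_ : (fun _ => _) = (fun u : RR => ((hyp u)^-1 ^+ n.+2)%:E *
    (e (r * (t * (u / hyp u)))%R (t ^+ 2)%R)%:E)%E).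
    apply: emeasurable_funM; first by apply/measurable_EFinP; meash.
    by apply: me; meash.
  by apply/funext => u; rewrite /E /e sqrtr_sqr gtr0_norm.
have -> : (\int[mu]_u G (t, u) = Phi t * \int[mu]_u (E u)%:E)%E.
  rewrite -ge0_integralZl//; last by move=> u _; rewrite lee_fin.
  apply: eq_integral => u _; rewrite /G /K /e /E /= xr' sqrtr_sqr gtr0_norm//.
  by rewrite muleCA -EFinM.
rewrite muleCA [leRHS]muleCA muleA -EFinM [leLHS]muleCA.
apply: lee_wpmul2l => //.
rewrite [X in (X%:E * _)%E]mulrC.
apply: le_trans (angular_integral_le_M3 n m0 t0 a1) _.
by rewrite -EFinM lee_fin [in leLHS]expr_div_n mulrA mulrAC.
Qed.

End convolution.

(** * The comparison theorem *)

Theorem theorem3p1 (R : realType) (d : nat) (m : R) (g : R -> \bar R)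
    (f : 'RR[R]_d -> \bar R) :
  (2 <= d)%N ->
  assumption_B m g f ->
  forall (n : nat) (x : 'RR[R]_d), (1 <= n)%N ->
    (hfun f n x <= (M3 d m ^+ n.-1)%:E * Hfun d g n (enorm x))%E.
Proof.
case: d f => [//|[//|d]] f _ [dens m0 fE [g_gt0 g_ni _]].
(* [g'] agrees with [g] on the nonnegative reals and is monotone everywhere. *)
pose g' (r : R) := g (Num.max 0 r).
have gg' r : 0 <= r -> g r = g' r by move=> r0; rewrite /g' max_r.
have g'0 r : (0 <= g' r)%E by apply/ltW/g_gt0; rewrite le_max lexx.
have mg' : measurable_fun setT (g' : measurableTypeR R -> \bar R).
  apply: nonincreasing_emeasurable => r s rs.
  apply: g_ni; first by rewrite le_max lexx.
  by rewrite ge_max !le_max lexx rs orbT.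
have HE := eq_Hfun d.+2 gg'.
have H0 n r : (0 <= Hfun d.+2 g n r)%E by rewrite HE; exact: Hfun_ge0.
have mH n : measurable_fun setT (Hfun d.+2 g n : measurableTypeR R -> \bar R).
  rewrite (_ : Hfun d.+2 g n = Hfun d.+2 g' n); last exact/funext.
  exact: measurable_Hfun.
have enorm_ge0 k (y : 'RR[R]_k) : 0 <= enorm y by exact: sqrtr_ge0.
have f0 y : (0 <= f y)%E by case: dens.
have h0 n y : (0 <= hfun f n y)%E.
  elim: n y => [|[|n] IH] y; rewrite ?lee_fin//=.
  rewrite mule_ge0 ?inve_ge0//; apply: integral_ge0 => z _.
  by rewrite !mule_ge0.
have M1 := M3_ge1 d.+2 m.
have Mk k : 0 <= M3 d.+2 m ^+ k by rewrite exprn_ge0// (le_trans _ M1).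
case=> [//|n] x _; elim: n x => [|n IH] x.
  by rewrite /= expr0 mul1e.
rewrite [_.-1]/=.
have hE : hfun f n.+2 x = ((\int[lebesgue_tuple d.+2]_(y in D_set x)
  (f (subt x y) * f y * hfun f n.+1 y)) / f x)%E by [].
(* Up to radius 2 the triangle inequality leaves no point in the domain. *)
have [r2|r2] := leP (enorm x) 2.
  rewrite hE; have -> : D_set x = set0.
    apply/seteqP; split=> // y [/= y1 y2].
    by have := enorm_triangle x y; lra.
  by rewrite integral_set0 mul0e mule_ge0// lee_fin.
rewrite {}hE; set r := enorm x in r2 *.
have r0 : 0 < r by lra.
have sr0 : 0 < Num.sqrt r by rewrite sqrtr_gt0.
have fxE : f x = ((expR (- m * r))%:E * g r)%E by exact: fE.
(* If [g r] is infinite, division by [f x] gives zero. *)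
move: (g_gt0 r (ltW r0)); case gr : (g r) => [y| |]// y0; last first.
  rewrite fxE gr gt0_muley ?lte_fin ?expR_gt0// invey mule0.
  by rewrite mule_ge0// lee_fin.
rewrite lte_fin in y0; rewrite gr -EFinM in fxE.
set a : R := (d.+2%:R - 1) / 2.
have aE : a = d.+1%:R / 2 by rewrite /a -[d.+2%:R]natr1 addrK.
pose C : R := M3 d.+2 m ^+ n * expR (- m * r).
have C0 : 0 <= C by rewrite mulr_ge0 ?expR_ge0.
pose J (t : R) : \bar R := (g' (r - t)%R * g' t * Hfun d.+2 g n.+1 t)%E.
have J0 t : (0 <= J t)%E by rewrite !mule_ge0.
have mJ : measurable_fun setT (J : measurableTypeR R -> \bar R).
  apply: emeasurable_funM; last exact: mH.
  apply: emeasurable_funM; last exact: mg'.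
  by apply: (measurableT_comp mg'); exact: measurable_funB.
(* [Phi] carries the factors that depend on [enorm y] alone, once [g] at the
   distance from [x] to [y] has been replaced by [g] at [r - enorm y]. *)
pose Phi (t : R) : \bar R := if 1 <= t <= r - 1 then (C%:E * J t)%E else 0%E.
have Phi0 t : (0 <= Phi t)%E.
  by rewrite /Phi; case: ifP => // _; rewrite mule_ge0// lee_fin.
have mPhi : measurable_fun setT (Phi : measurableTypeR R -> \bar R).
  apply: measurable_fun_ifT => //; last exact: measurable_funeM.
  by apply: measurable_and; apply: measurable_fun_ler => //.
have Phi_out t : ~~ (1 <= t <= r - 1) -> Phi t = 0%E.
  by rewrite /Phi => /negbTE ->.
have shell := integral_shell_le m0 r0 (erefl r) mPhi Phi0 Phi_out.
have int_le : (\int[lebesgue_tuple d.+2]_(z in D_set x)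
    (f (subt x z) * f z * hfun f n.+1 z) <=
    \int[lebesgue_tuple d.+2]_z (Phi (enorm z) * (expR (- m *
      (Num.sqrt (r ^+ 2 + sqn z - 2 * dotp x z) + enorm z - r)))%:E))%E.
  rewrite integral_mkcond; apply: ge0_le_integralT => z.
    by apply: erestrict_ge0 => w _; rewrite !mule_ge0.
  rewrite patchE; case: ifPn => [|_]; last by rewrite mule_ge0// lee_fin expR_ge0.
  rewrite inE => -[]; rewrite -/r; set t := enorm z => tr.
  have -> : Num.sqrt (r ^+ 2 + sqn z - 2 * dotp x z) = enorm (subt x z).
    have -> : r ^+ 2 = sqn x by rewrite sqr_sqrtr// sqn_ge0.
    by rewrite -sqn_subt.
  set s := enorm (subt x z) => sr.
  have tri : r <= t + s := enorm_triangle x z.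
  rewrite /Phi ifT; last by apply/andP; split; lra.
  have -> : f (subt x z) = ((expR (- m * s))%:E * g s)%E by exact: fE.
  have -> : f z = ((expR (- m * t))%:E * g' t)%E.
    by rewrite -gg' ?enorm_ge0//; exact: fE.
  have gs : (g s <= g' (r - t)%R)%E.
    by rewrite -gg'; [apply: g_ni|]; lra.
  have gs0 : (0 <= g s)%E by rewrite gg' ?enorm_ge0.
  apply: (@le_trans _ _ (((expR (- m * s))%:E * g' (r - t)%R) *
    ((expR (- m * t))%:E * g' t) *
    ((M3 d.+2 m ^+ n)%:E * Hfun d.+2 g n.+1 t)))%E.
    apply: lee_pmul => //; rewrite ?mule_ge0 ?lee_fin ?expR_ge0//.
      apply: lee_pmul => //; rewrite ?mule_ge0 ?lee_fin ?expR_ge0//.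
      by rewrite lee_wpmul2l// lee_fin expR_ge0.
  rewrite (muleACA (expR (- m * s))%:E).
  rewrite (muleACA ((expR (- m * s))%:E * (expR (- m * t))%:E)%E).
  rewrite [leRHS]muleAC -!EFinM -expRD.
  rewrite /C -mulrA -expRD [X in (X%:E * _)%E]mulrC.
  have -> : - m * s + - m * t = - m * r + - m * (s + t - r) by ring.
  exact: lexx.
have {int_le shell} := le_trans int_le shell.
set I := (\int[_]_(z in _) _)%E => int_le.
have -> : Hfun d.+2 g n.+2 r = ((y * Num.sqrt r ^+ d.+1)^-1%:E *
    \int[@lebesgue_measure R]_(rho in `[1%R, (r - 1)%R])
      (J rho * ((Num.sqrt (r - rho) * Num.sqrt rho) ^+ d.+1)%:E))%E.
  rewrite (HfunSS d.+2 g n r2) -/a aE gr powR_half ?(ltW r0)// -EFinM inver.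
  rewrite ifF; last by rewrite gt_eqF// mulr_gt0// exprn_gt0.
  apply: congr1; apply: eq_integral => t t_in.
  have /andP[t1 tr] : 1 <= t <= r - 1 by move: t_in; rewrite inE/= in_itv.
  rewrite !powR_half; [|lra|lra].
  rewrite exprMn EFinM /J -!gg'; [|lra|lra].
  have AC (A u B v H : \bar R) : (A * u * B * v * H = A * B * H * (u * v))%E.
    by rewrite (muleAC A u) -(muleA _ u v) (muleAC (A * B)%E).
  exact: AC.
have JI : (\int[@lebesgue_measure R]_(rho in `[1%R, (r - 1)%R])
     (Phi rho * ((Num.sqrt (r - rho) * Num.sqrt rho) ^+ d.+1)%:E) =
   C%:E * \int[@lebesgue_measure R]_(rho in `[1%R, (r - 1)%R])
      (J rho * ((Num.sqrt (r - rho) * Num.sqrt rho) ^+ d.+1)%:E))%E.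
  rewrite -ge0_integralZl//.
  - apply: eq_integral => t; rewrite inE/= in_itv/= => t1.
    by rewrite /Phi t1 [RHS]muleA.
  - apply/measurable_funTS/emeasurable_funM => //.
    apply/measurable_EFinP; apply: measurable_funX; apply: measurable_funM.
      by apply: (measurableT_comp measurable_sqrt); exact: measurable_funB.
    exact: measurable_sqrt.
  - by move=> t _; rewrite mule_ge0// lee_fin exprn_ge0// mulr_ge0 ?sqrtr_ge0.
move: int_le; rewrite {}JI; set L := (\int[_]_(rho in _) _)%E => int_le.
have E0 : 0 < expR (- m * r) * y by rewrite mulr_gt0 ?expR_gt0.
have fV0 : (0 <= (expR (- m * r) * y)^-1%:E)%E by rewrite lee_fin invr_ge0 ltW.
rewrite fxE inver gt_eqF//.
apply: le_trans (lee_wpmul2r fV0 int_le) _.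
rewrite muleA -EFinM muleAC -EFinM muleA -EFinM.
rewrite le_eqVlt; apply/orP; left; apply/eqP; congr (_%:E * _)%E.
rewrite /C (exprS (M3 d.+2 m)); field.
by rewrite !gt_eqF ?expR_gt0// exprn_gt0.
Qed.
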